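(* On the domain $s<-3$, $-\tfrac32<t<0$, $0<\theta<\pi$, with $\phi,\tau,\chi$ periodic of periods $2\pi$, $2\pi$, $\tfrac32\pi$, consider the metric $$g=\frac14 st\left(d\theta^2+\sin^2\theta\,d\phi^2\right)+\frac{t-s}{4Q(s)}ds^2+\frac{3(s-t)}{4t(2t+3)}dt^2+\frac{Q(s)}{t-s}\left[\left(\tfrac t3+1\right)d\chi-\tfrac t2\,\eta\right]^2+\frac{t(2t+3)}{3(s-t)}\left[\left(\tfrac s3+1\right)d\chi-\tfrac s2\,\eta\right]^2,$$ where $Q(s)=\frac{2s^2}{3}+s+\frac9s$ and $\eta=d\tau+(1-\cos\theta)d\phi$. Setting $s=-\tfrac23R^2$, as $R\to\infty$ one has, at leading order, $$g\approx dR^2+R^2\,ds^2_{X_5},$$ where $$ds^2_{X_5}=-\frac t6\left(d\theta^2+\sin^2\theta\,d\phi^2\right)-\frac{dt^2}{2t(2t+3)}-\frac{2t(2t+3)}{9}\left[\tfrac{d\chi}{3}-\tfrac12\eta\right]^2+\frac49\left[\left(\tfrac t3+1\right)d\chi-\tfrac t2\eta\right]^2 .$$ Moreover $ds^2_{X_5}$ is the round (Sasaki–Einstein, $R_{ij}=4g_{ij}$) metric of the orbifold $\mathbb{S}^5/\mathbb{Z}_4$, where $\mathbb{S}^5\subset\mathbb{C}^3$ is the unit sphere and the generator of $\mathbb{Z}_4$ acts by $(z_1,z_2,z_3)\mapsto(i z_1,i z_2,-z_3)$; that is, the asymptotic cone is $\mathbb{C}^3/\mathbb{Z}_4$.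
   Context: ''At leading order'' means: written in the coordinates $(R,t,\theta,\phi,\tau,\chi)$, the coefficient of $dR^2$ in $g$ tends to $1$, and $R^{-2}$ times the remaining part of $g$ (which contains no $dR$) tends coefficientwise, as $R\to\infty$ with the other coordinates fixed, to $ds^2_{X_5}$. The identification of $ds^2_{X_5}$ with the metric of $\mathbb{S}^5/\mathbb{Z}_4$ is an isometry of the space with coordinates $(t,\theta,\phi,\tau,\chi)$ (with the stated ranges and periodicities) onto a dense open subset of $\mathbb{S}^5/\mathbb{Z}_4$. *)

(* Defs.v *)
From HB Require Import structures.
From mathcomp Require Import all_boot all_order all_algebra.
From mathcomp Require Import all_classical all_reals all_analysis.
From mathcomp Require Import complex.

Set Implicit Arguments.
Unset Strict Implicit.
Unset Printing Implicit Defensive.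

Import Order.TTheory GRing.Theory Num.Theory.
Import numFieldNormedType.Exports.

Local Open Scope classical_set_scope.
Local Open Scope ring_scope.
Local Open Scope quotient_scope.
Local Open Scope complex_scope.

(** * Tensor calculus in a coordinate chart

    Points are row vectors of coordinates.  A metric is a matrix-valued
    function [g], with [g x i j] the coefficient of [dx^i (x) dx^j]. *)

Section Calculus.
Context {R : realType} {n : nat}.
Implicit Types (A L : set 'rV[R]_n) (g J : 'rV[R]_n -> 'M[R]_n).

Definition partial {W : normedModType R} (i : 'I_n) (f : 'rV[R]_n -> W) :
  'rV[R]_n -> W := fun x => 'D_(delta_mx 0 i) f x.

Definition iter_partial {W : normedModType R} (s : seq 'I_n)
    (f : 'rV[R]_n -> W) : 'rV[R]_n -> W :=
  foldr partial f s.

(** [C^oo] on the open set [A]: all iterated partial derivatives are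
    (Frechet) differentiable at the points of [A]. *)
Definition smooth_on {W : normedModType R} A (f : 'rV[R]_n -> W) : Prop :=
  forall (s : seq 'I_n) x, A x -> differentiable (iter_partial s f) x.

(** The symmetric square of the one-form [\sum_i w_i dx^i]. *)
Definition sq (w : 'rV[R]_n) : 'M[R]_n := w^T *m w.

(** [christoffel g k i j x] is [Gamma^k_{ij}(x)]. *)
Definition christoffel g (k i j : 'I_n) (x : 'rV[R]_n) : R :=
  2^-1 * \sum_l invmx (g x) k l *
    (partial i (fun y => g y j l) x + partial j (fun y => g y i l) x
     - partial l (fun y => g y i j) x).

Definition ricci g (x : 'rV[R]_n) : 'M[R]_n := \matrix_(i, j)
  (\sum_k partial k (christoffel g k i j) x
   - \sum_k partial j (christoffel g k i k) x
   + \sum_k \sum_l (christoffel g k k l x * christoffel g l i j x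
                    - christoffel g k j l x * christoffel g l i k x)).

(** [g] is Kaehler on the quotient of [A] by the translations in [L]: there is
    a [g]-orthogonal parallel almost complex structure, with [J (d_i) =
    \sum_j (J x i j) d_j]; invariance under [L] makes it descend. *)
Definition kaehler A L g : Prop :=
  exists J,
    [/\ smooth_on A J,
        forall x v, A x -> L v -> J (x + v) = J x,
        forall x, A x -> J x *m J x = - 1%:M,
        forall x, A x -> J x *m g x *m (J x)^T = g x
      & forall x, A x -> forall k i j : 'I_n,
          partial k (fun y => J y i j) x
          + \sum_l J x i l * christoffel g j k l x
          - \sum_l christoffel g l k i x * J x l j = 0].

(** The pullback of the tensor [h] by [f], in coordinates. *)
Definition pullback {m} (f : 'rV[R]_n -> 'rV[R]_m) (h : 'rV[R]_m -> 'M[R]_m) :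
  'rV[R]_n -> 'M[R]_n :=
  fun x => 'J f x *m h (f x) *m ('J f x)^T.

End Calculus.

Section Cone.
Context {R : realType} {n : nat}.
Implicit Types (A L : set 'rV[R]_n) (g : 'rV[R]_n -> 'M[R]_n).

(** The metric cone [dr^2 + r^2 g] on [(0, +oo) x A]; the radius is the first
    coordinate. *)
Definition cone_point (r : R) (x : 'rV[R]_n) : 'rV[R]_(1 + n) :=
  row_mx r%:M x.

Definition cone_domain A : set 'rV[R]_(1 + n) :=
  [set y : 'rV[R]_(1 + n) | 0 < y 0 0 /\ A (rsubmx y)].

Definition cone_lattice L : set 'rV[R]_(1 + n) :=
  [set cone_point 0 v | v in L].

Definition cone_metric g : 'rV[R]_(1 + n) -> 'M[R]_(1 + n) :=
  fun y => block_mx 1%:M 0 0 (y 0 0 ^+ 2 *: g (rsubmx y)).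

Definition sasakian A L g : Prop :=
  kaehler (cone_domain A) (cone_lattice L) (cone_metric g).

Definition einstein A g (lambda : R) : Prop :=
  forall x, A x -> ricci g x = lambda *: g x.

End Cone.

(** * The orbifolds [S^5/Z_4] and [C^3/Z_4]

    [C^3] is carried by ['rV[R]_(3 + 3)], real parts first, so that it has the
    Euclidean topology and real Jacobians. *)

Section Orbifold.
Context {R : realType}.

Definition complex_coord (p : 'rV[R]_(3 + 3)) : 'rV[R[i]]_3 :=
  \row_j (p 0 (lshift 3 j) +i* p 0 (rshift 3 j)).

Definition of_complex (z : 'rV[R[i]]_3) : 'rV[R]_(3 + 3) :=
  row_mx (map_mx (@complex.Re R) z) (map_mx (@complex.Im R) z).

Definition generator (p : 'rV[R]_(3 + 3)) : 'rV[R]_(3 + 3) :=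
  let z := complex_coord p in
  of_complex (\row_j [:: 'i * z 0 0; 'i * z 0 1; - z 0 2]`_j).

Definition S5 : set 'rV[R]_(3 + 3) :=
  [set p | \sum_j `|complex_coord p 0 j| ^+ 2 = 1].

Lemma complex_coordK : cancel complex_coord of_complex.
Proof.
move=> p; apply/rowP => k; rewrite /of_complex.
by case: (split_ordP k) => j ->; rewrite ?row_mxEl ?row_mxEr !mxE.
Qed.

Lemma of_complexK : cancel of_complex complex_coord.
Proof.
move=> z; apply/rowP => j; rewrite mxE row_mxEl row_mxEr !mxE.
by case: (z 0 j).
Qed.

Lemma generator4 (p : 'rV[R]_(3 + 3)) : iter 4 generator p = p.
Proof.
rewrite -[RHS]complex_coordK /= /generator !of_complexK; congr of_complex.
move: (complex_coord p) => z; have i2 (a : R[i]) : 'i * ('i * a) = - a.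
  rewrite mulrA -mulN1r; congr (_ * _).
  by apply/eqP; rewrite eq_complex /= !mul0r mulr1 sub0r mulr0 addr0 oppr0 !eqxx.
by apply/rowP => j; rewrite mxE; case: j => [[|[|[|//]]] lt_j] /=;
  rewrite !mxE /= ?mxE /= ?mxE /= ?i2 ?opprK; congr (z 0 _); apply: val_inj.
Qed.


(** The orbit relation of the group generated by [generator], on a set [M]. *)
Definition orbit_rel (M : set 'rV[R]_(3 + 3)) : rel M :=
  fun p q => [exists k : 'I_4, set_val q == iter k generator (set_val p)].

Lemma orbit_relP (M : set 'rV[R]_(3 + 3)) (p q : M) :
  reflect (exists k, set_val q = iter k generator (set_val p)) (orbit_rel p q).
Proof.
apply: (iffP existsP) => [[k /eqP ->]|[k ->]]; first by exists k.
exists (inord (k %% 4)); rewrite inordK ?ltn_mod// {1}(divn_eq k 4) addnC.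
rewrite iterD; apply/eqP; congr iter; elim: (k %/ 4)%N => [//|m IH].
by rewrite mulSn iterD IH generator4.
Qed.

Lemma orbit_rel_equiv (M : set 'rV[R]_(3 + 3)) :
  equiv_class_of (@orbit_rel M).
Proof.
have symr (p q : M) : orbit_rel p q -> orbit_rel q p.
  case/existsP => k /eqP qE; apply/orbit_relP; exists (4 - k)%N.
  by rewrite qE -iterD subnK ?generator4// ltnW.
split.
- by move=> p; apply/orbit_relP; exists 0%N.
- by move=> p q; apply/idP/idP; exact: symr.
- move=> q p r /orbit_relP[k qE] /orbit_relP[l rE]; apply/orbit_relP.
  by exists (l + k)%N; rewrite iterD -qE.
Qed.

Canonical orbit_equiv (M : set 'rV[R]_(3 + 3)) :=
  EquivRelPack (orbit_rel_equiv M).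

(** [M/Z_4] with the quotient of the subspace topology. *)
Definition orbit_space (M : set 'rV[R]_(3 + 3)) : topologicalType :=
  quotient_topology {eq_quot @orbit_equiv M}.

Definition orbit_proj (M : set 'rV[R]_(3 + 3)) : M -> orbit_space M :=
  \pi_(quotient_topology {eq_quot @orbit_equiv M}).

(** [F] induces an isometry from the quotient of [(A, g)] by the translations
    in [L] onto a dense open subset of [M/Z_4], with the metric induced by the
    Euclidean metric of [C^3].  Smooth maps to an orbifold are those with
    smooth local lifts; when [n] is the dimension of [M] and [g] is definite,
    the lifts are local diffeomorphisms, so the inverse is smooth as well. *)
Definition isometry_onto_dense_open (n : nat) (A L : set 'rV[R]_n)
    (g : 'rV[R]_n -> 'M[R]_n) (M : set 'rV[R]_(3 + 3))
    (F : 'rV[R]_n -> orbit_space M) : Prop :=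
  [/\ forall x, A x -> exists (V : set 'rV[R]_n) (lift : 'rV[R]_n -> M),
        let Phi := set_val \o lift in
        [/\ open V /\ V x, V `<=` A, smooth_on V Phi,
            forall y, V y -> orbit_proj (lift y) = F y
          & forall y, V y -> pullback Phi (fun=> 1%:M) y = g y],
      forall x y, A x -> A y -> (F x = F y <-> L (y - x)),
      open (F @` A)
    & dense (F @` A)].

End Orbifold.

(** * The metrics *)

Section Metrics.
Context {R : realType}.

Definition Q (s : R) : R := 2 * s ^+ 2 / 3 + s + 9 / s.

(** Coordinates [(s, t, theta, phi, tau, chi)]; the angles [phi, tau, chi]
    range over the reals, their periodicity being given by [period_lattice]. *)
Definition g_domain : set 'rV[R]_(1 + 5) :=
  [set x : 'rV[R]_(1 + 5) |
    [/\ x 0 0 < -3, - (3 / 2) < x 0 1 < 0 & 0 < x 0 2 < pi]].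

Definition g_metric (x : 'rV[R]_(1 + 5)) : 'M[R]_(1 + 5) :=
  let s := x 0 0 in let t := x 0 1 in let theta := x 0 2 in
  let d (k : 'I_(1 + 5)) : 'rV[R]_(1 + 5) := delta_mx 0 k in
  let ds := d 0 in let dt := d 1 in let dtheta := d 2 in
  let dphi := d 3 in let dtau := d 4 in let dchi := d 5 in
  let eta := dtau + (1 - cos theta) *: dphi in
  (1 / 4 * s * t) *: (sq dtheta + sin theta ^+ 2 *: sq dphi)
  + ((t - s) / (4 * Q s)) *: sq ds
  + (3 * (s - t) / (4 * t * (2 * t + 3))) *: sq dt
  + (Q s / (t - s)) *: sq ((t / 3 + 1) *: dchi - (t / 2) *: eta)
  + (t * (2 * t + 3) / (3 * (s - t))) *:
      sq ((s / 3 + 1) *: dchi - (s / 2) *: eta).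

(** The substitution [s = - 2/3 R^2]. *)
Definition s_of_radius (y : 'rV[R]_(1 + 5)) : 'rV[R]_(1 + 5) :=
  cone_point (- (2 / 3) * (y 0 0) ^+ 2) (rsubmx y).

(** Coordinates [(t, theta, phi, tau, chi)]. *)
Definition X5_domain : set 'rV[R]_5 :=
  [set x : 'rV[R]_5 | - (3 / 2) < x 0 0 < 0 /\ 0 < x 0 1 < pi].

Definition period_lattice : set 'rV[R]_5 :=
  [set v | exists k l m : int,
     v = (2 * pi * k%:~R) *: delta_mx 0 2 + (2 * pi * l%:~R) *: delta_mx 0 3
         + (3 / 2 * pi * m%:~R) *: delta_mx 0 4].

Definition X5_metric (x : 'rV[R]_5) : 'M[R]_5 :=
  let t := x 0 0 in let theta := x 0 1 in
  let d (k : 'I_5) : 'rV[R]_5 := delta_mx 0 k in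
  let dt := d 0 in let dtheta := d 1 in
  let dphi := d 2 in let dtau := d 3 in let dchi := d 4 in
  let eta := dtau + (1 - cos theta) *: dphi in
  (- (t / 6)) *: (sq dtheta + sin theta ^+ 2 *: sq dphi)
  - (2 * t * (2 * t + 3))^-1 *: sq dt
  - (2 * t * (2 * t + 3) / 9) *: sq (3^-1 *: dchi - 2^-1 *: eta)
  + (4 / 9) *: sq ((t / 3 + 1) *: dchi - (t / 2) *: eta).

End Metrics.

(* Main.v *)
Require Import Defs.
From HB Require Import structures.
From mathcomp Require Import all_boot all_order all_algebra.
From mathcomp Require Import all_classical all_reals all_analysis.
From mathcomp Require Import complex.
From mathcomp Require Import ring lra.

Set Implicit Arguments.
Unset Strict Implicit.
Unset Printing Implicit Defensive.

Import Order.TTheory GRing.Theory Num.Theory.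
Import numFieldNormedType.Exports.

Local Open Scope classical_set_scope.
Local Open Scope ring_scope.

(** The coordinates [(r, t, theta, phi, tau, chi)] are polar coordinates of [C^3]
    in disguise. Put [rho = sqrt (- 2t/3)] and [sigma = sqrt (1 + 2t/3)], so that
    [rho^2 + sigma^2 = 1], and let [cone_map] send a point of the cone to
    [z = r (rho cos (theta/2) e^(i a), rho sin (theta/2) e^(i (a + phi)),
    sigma e^(2 i chi/3))] with [a = tau/2 + chi/3]. In terms of the moduli [A_j] and
    the arguments [a_j] of the coordinates the flat metric is [\sum_j dA_j^2 +
    A_j^2 da_j^2], and a computation with half angles ([frame_gram]) identifies it
    with [dr^2 + r^2 ds^2_X5]. Everything about [ds^2_X5] follows.

    The isometry. The moduli determine [r], [t] and [theta]; the arguments determine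
    the three angles up to multiples of [2 pi] of each argument, and the generator of
    [Z_4] adds [(pi/2, pi/2, pi)] to the arguments. The translations of
    [(phi, tau, chi)] that preserve the [Z_4]-orbit of [z] are therefore exactly those
    in the period lattice ([cone_map_orbit]). The image consists of the orbits with
    no vanishing coordinate ([cone_map_surj]), an open dense set ([regular_image]).
    The slice [r = 1] gives the same statement for the sphere.

    The geometry. A metric induced by a map [Phi] to Euclidean space has
    [<d_i d_j Phi, d_l Phi>] as its Christoffel symbols of the first kind, by the
    symmetry of second derivatives ([schwarz], [connectionE]). For the flat cone the
    second derivatives of [Phi] are combinations of the first ones, whence
    multiplication by [i] is parallel ([kaehler_of_flat]); it is invariant under
    translations of the angles because these act by unitary diagonal matrices. For the
    sphere Gauss' formula [d_i d_j Phi = \sum_k Gamma^k_ij d_k Phi - g_ij Phi],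
    differentiated once more, gives constant curvature one and so [Ric = 4 g]
    ([einstein_of_sphere]).

    The asymptotics. With [s = - 2/3 r^2] the coefficients of [g] divided by [r^2] are
    rational functions of [r^-2] that are regular at zero ([cone_asymptotics]). *)
(** * Partial derivatives and smooth maps *)

Lemma differentiable_eq_on {R : realType} {V W : normedModType R} (A : set V)
  (f g : V -> W) : open A -> (forall x, A x -> f x = g x) ->
  forall x, A x -> differentiable f x -> differentiable g x.
Proof.
move=> oA fg x Ax /diff_locallyP[dfc fE].
have gE : g \o shift x = cst (g x) + 'd f x +o_ 0 id.
  apply/eqaddoP => e e0; have /eqaddoP/(_ e e0) := fE.
  have near_fg : \forall y \near nbhs (0 : V), f (y + x) = g (y + x).
    have : \forall y \near x, f y = g y.
      by apply: filterS (open_nbhs_nbhs (conj oA Ax)) => y /fg.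
    by rewrite (near_shift 0 x); apply: filterS => y /=; rewrite subr0.
  apply: filterS2 near_fg => y /= fgy.
  by rewrite !fctE /= fgy (fg x Ax).
by apply/diff_locallyP; rewrite (diff_unique dfc gE).
Qed.

(** A locked copy of [partial]: unification never unfolds a derivative to the
    limit that defines it, which it would do when it compares two partial
    derivatives of the same function. *)
HB.lock Definition pd {R : realType} {n : nat} {W : normedModType R} (i : 'I_n)
  (f : 'rV[R]_n -> W) : 'rV[R]_n -> W := partial i f.

Lemma pdE {R : realType} {n : nat} {W : normedModType R} (i : 'I_n)
  (f : 'rV[R]_n -> W) x : pd i f x = 'D_(delta_mx 0 i) f x.
Proof. by rewrite pd.unlock. Qed.

Lemma pd_partial {R : realType} {n : nat} {W : normedModType R} (i : 'I_n)
  (f : 'rV[R]_n -> W) : pd i f = partial i f.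
Proof. by rewrite pd.unlock. Qed.

(** Locked for the same reason as [pd]: an entry of ['J f x] unfolds to a limit. *)
HB.lock Definition jac {R : realType} {n m : nat} (f : 'rV[R]_n -> 'rV[R]_m) x :
  'M[R]_(n, m) := 'J f x.

Lemma jacE {R : realType} {n m : nat} (f : 'rV[R]_n -> 'rV[R]_m) : jac f = jacobian f.
Proof. by rewrite jac.unlock. Qed.

Section Partial.
Context {R : realType} {n : nat}.
Implicit Types (A : set 'rV[R]_n) (x : 'rV[R]_n).

Lemma pd_eq_on {W : normedModType R} A (f g : 'rV[R]_n -> W) i :
  open A -> (forall x, A x -> f x = g x) ->
  forall x, A x -> pd i f x = pd i g x.
Proof.
move=> oA fg x Ax; rewrite !pdE; apply: near_eq_derive.
by apply: filterS (open_nbhs_nbhs (conj oA Ax)) => y /fg.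
Qed.

Lemma differentiable_mxP {p q} (M : 'rV[R]_n -> 'M[R]_(p, q)) x :
  differentiable M x <-> forall i j, differentiable (fun y => M y i j) x.
Proof.
split=> [dM i j|dM].
  exact: (differentiable_comp dM (@differentiable_coord _ _ _ _ i j)).
have -> : M = \sum_i \sum_j (fun y => M y i j *: delta_mx i j).
  apply/funext => y; rewrite {1}(matrix_sum_delta (M y)) fct_sumE.
  by apply: eq_bigr => i _; rewrite fct_sumE.
apply: differentiable_sum => i; apply: differentiable_sum => j.
exact: differentiableZl.
Qed.

Lemma pd_mx {p q} (M : 'rV[R]_n -> 'M[R]_(p, q)) x k i j :
  differentiable M x -> pd k M x i j = pd k (fun y => M y i j) x.
Proof. by move=> dM; rewrite !pdE derive_mx ?mxE//; exact: diff_derivable. Qed.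

Lemma jac_pd {m} (f : 'rV[R]_n -> 'rV[R]_m) x i j :
  differentiable f x -> jac f x i j = pd i (fun y => f y 0 j) x.
Proof.
move=> df; rewrite -pd_mx// !pdE deriveEjacobian// jacE.
by rewrite -rowE [RHS]mxE.
Qed.

Lemma pdD {W : normedModType R} (f g : 'rV[R]_n -> W) i x : differentiable f x -> differentiable g x ->
  pd i (fun y => f y + g y) x = pd i f x + pd i g x.
Proof. by move=> df dg; rewrite !pdE; apply: deriveD; exact: diff_derivable. Qed.

Lemma pdB {W : normedModType R} (f g : 'rV[R]_n -> W) i x : differentiable f x -> differentiable g x ->
  pd i (fun y => f y - g y) x = pd i f x - pd i g x.
Proof. by move=> df dg; rewrite !pdE; apply: deriveB; exact: diff_derivable. Qed.

Lemma pd_cst {W : normedModType R} (c : W) i x : pd i (fun=> c) x = 0.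
Proof. by rewrite pdE derive_cst. Qed.

Section Scalar.
Implicit Types f g : 'rV[R]_n -> R.

Lemma pdM f g i x : differentiable f x -> differentiable g x ->
  pd i (fun y => f y * g y) x = pd i f x * g x + f x * pd i g x.
Proof.
move=> df dg; rewrite !pdE [LHS]deriveM; try exact: diff_derivable.
by rewrite addrC [g x *: _]mulrC.
Qed.

Lemma pd_sum (I : Type) (s : seq I) (f : I -> 'rV[R]_n -> R) i x :
  (forall k, differentiable (f k) x) ->
  differentiable (fun y => \sum_(k <- s) f k y) x /\
  pd i (fun y => \sum_(k <- s) f k y) x = \sum_(k <- s) pd i (f k) x.
Proof.
move=> df; elim: s => [|k s [dS pS]].
  under eq_fun do rewrite big_nil; split; first exact: differentiable_cst.
  by rewrite big_nil pd_cst.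
under eq_fun do rewrite big_cons; split; first exact: differentiableD.
by rewrite pdD// pS big_cons.
Qed.

Lemma pd_coord i j x : pd i (fun y : 'rV[R]_n => y 0 j) x = (i == j)%:R.
Proof.
rewrite -[LHS](@pd_mx _ _ id); last exact: ex_diff.
by rewrite !pdE derive_id mxE eqxx eq_sym.
Qed.

Lemma differentiable_chain (h : R -> R) h' f x :
  differentiable f x -> is_derive (f x) 1 h h' -> differentiable (h \o f) x.
Proof.
by move=> df [dh _]; apply: differentiable_comp => //; exact/derivable1_diffP.
Qed.

Lemma pd_chain (h : R -> R) h' f i x :
  differentiable f x -> is_derive (f x) 1 h h' ->
  pd i (h \o f) x = h' * pd i f x.
Proof.
move=> df [/derivable1_diffP dh hE]; rewrite !pdE !deriveE//; last first.
  exact: differentiable_comp.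
rewrite diff_comp//= -[X in 'd h _ X]mulr1 [LHS]linearZ /=.
by rewrite -hE deriveE// [LHS]mulrC.
Qed.

End Scalar.
End Partial.

Section Smooth.
Context {R : realType} {n : nat}.
Implicit Types (A : set 'rV[R]_n) (f g : 'rV[R]_n -> R).

(** Class [C^k] in the sense needed for induction: the iterated partial
    derivatives up to order [k] are differentiable, so that [k = 0] already
    asks for differentiability. *)
Fixpoint cont_diff {W : normedModType R} A k (f : 'rV[R]_n -> W) : Prop :=
  (forall x, A x -> differentiable f x) /\
  if k is k'.+1 then forall i, cont_diff A k' (pd i f) else True.

(** [iter_partial] applies the last index of the list first, whence the
    induction from the right. *)
Lemma smooth_onP {W : normedModType R} A (f : 'rV[R]_n -> W) :
  smooth_on A f <-> forall k, cont_diff A k f.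
Proof.
split=> [sf k|Cf s x Ax].
  elim: k f sf => [|k IH] f sf; (split; first by move=> x Ax; exact: (sf [::])) => // i.
  by apply: IH => s x Ax; have := sf (rcons s i) x Ax;
    rewrite /iter_partial foldr_rcons -pd_partial.
elim/last_ind: s f Cf => [|s i IH] f Cf; first exact: (Cf 0%N).1.
rewrite /iter_partial foldr_rcons -pd_partial; apply: IH => k.
by have [_] := Cf k.+1; exact.
Qed.

Lemma cont_diffW {W : normedModType R} A k (f : 'rV[R]_n -> W) :
  cont_diff A k.+1 f -> cont_diff A k f.
Proof.
elim: k f => [|k IH] f [df Cf]; split=> // i.
exact: IH.
Qed.

Lemma cont_diff_differentiable {W : normedModType R} A k (f : 'rV[R]_n -> W) :
  cont_diff A k f -> forall x, A x -> differentiable f x.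
Proof. by case: k => [|k] []. Qed.

Lemma cont_diff_eq {W : normedModType R} A k (f g : 'rV[R]_n -> W) :
  open A -> (forall x, A x -> f x = g x) -> cont_diff A k f -> cont_diff A k g.
Proof.
move=> oA; elim: k f g => [|k IH] f g fg [df Cf]; (split; [move=> x Ax|]); [|by []| |move=> i].
- exact: (differentiable_eq_on oA fg Ax (df x Ax)).
- exact: (differentiable_eq_on oA fg Ax (df x Ax)).
- by apply: IH (Cf i) => x Ax; apply: (pd_eq_on _ oA).
Qed.

Lemma cont_diff_cst A k (c : R) : cont_diff A k (fun=> c).
Proof.
elim: k c => [|k IH] c; split=> // i.
by have -> : pd i (fun=> c) = fun=> 0 by apply/funext => x; exact: pd_cst.
Qed.

Section OpenDomain.
Variable (A : set 'rV[R]_n).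
Hypothesis oA : open A.

Lemma cont_diffD k f g :
  cont_diff A k f -> cont_diff A k g -> cont_diff A k (fun x => f x + g x).
Proof.
elim: k f g => [|k IH] f g [df Cf] [dg Cg]; (split; [move=> x Ax|]); [|by []| |move=> i].
- exact: differentiableD (df x Ax) (dg x Ax).
- exact: differentiableD (df x Ax) (dg x Ax).
- apply: cont_diff_eq oA _ (IH _ _ (Cf i) (Cg i)) => x Ax.
  by rewrite pdD//; [exact: df|exact: dg].
Qed.

(** By the Leibniz rule the partial derivatives of [f * g] are sums of products
    of functions of class one less. *)
Lemma cont_diffM k f g :
  cont_diff A k f -> cont_diff A k g -> cont_diff A k (fun x => f x * g x).
Proof.
elim: k f g => [|k IH] f g.
  by move=> [df _] [dg _]; split=> // x Ax; exact: differentiableM (df x Ax) (dg x Ax).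
move=> Cf Cg; have [df Cf'] := Cf; have [dg Cg'] := Cg; split=> [x Ax|i].
  exact: differentiableM (df x Ax) (dg x Ax).
apply: cont_diff_eq oA _ (cont_diffD (IH _ _ (Cf' i) (cont_diffW Cg))
                                     (IH _ _ (cont_diffW Cf) (Cg' i))) => x Ax.
by rewrite pdM//; [exact: df|exact: dg].
Qed.

(** The derivative of [h \o f] is [(h' \o f) * f'], so that the class of [h \o f]
    depends only on lower classes of [h' \o f]. *)
Lemma cont_diff_chain k (h h' : R -> R) f :
  (forall x, A x -> is_derive (f x) 1 h (h' (f x))) ->
  (forall l, (l < k)%N -> cont_diff A l f -> cont_diff A l (h' \o f)) ->
  cont_diff A k f -> cont_diff A k (h \o f).
Proof.
case: k => [|k] dh Ch'.
  by move=> [df _]; split=> // x Ax; exact: differentiable_chain (df x Ax) (dh x Ax).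
move=> Cf; have [df Cf'] := Cf; split=> [x Ax|i].
  exact: differentiable_chain (df x Ax) (dh x Ax).
apply: cont_diff_eq oA _ (cont_diffM (Ch' k (ltnSn k) (cont_diffW Cf)) (Cf' i)) => x Ax.
by rewrite (pd_chain i (df x Ax) (dh x Ax)).
Qed.

Lemma smooth_cst (c : R) : smooth_on A (fun=> c).
Proof. by apply/smooth_onP => k; exact: cont_diff_cst. Qed.

Lemma smooth_coord j : smooth_on A (fun x => x 0 j).
Proof.
apply/smooth_onP => -[|k]; (split; [by move=> x _; exact: differentiable_coord|]) => // i.
have -> : pd i (fun x : 'rV[R]_n => x 0 j) = fun=> (i == j)%:R.
  by apply/funext => x; rewrite pd_coord.
exact: cont_diff_cst.
Qed.

Lemma smoothD f g : smooth_on A f -> smooth_on A g -> smooth_on A (fun x => f x + g x).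
Proof. by move=> /smooth_onP Cf /smooth_onP Cg; apply/smooth_onP => k; apply: cont_diffD. Qed.

Lemma smoothM f g : smooth_on A f -> smooth_on A g -> smooth_on A (fun x => f x * g x).
Proof. by move=> /smooth_onP Cf /smooth_onP Cg; apply/smooth_onP => k; apply: cont_diffM. Qed.

Lemma smooth_sum (I : Type) (s : seq I) (f : I -> 'rV[R]_n -> R) :
  (forall i, smooth_on A (f i)) -> smooth_on A (fun x => \sum_(i <- s) f i x).
Proof.
move=> Cf; elim: s => [|i s IH].
  by under eq_fun do rewrite big_nil; exact: smooth_cst.
by under eq_fun do rewrite big_cons; exact: smoothD.
Qed.

Lemma smooth_prod (I : Type) (s : seq I) (f : I -> 'rV[R]_n -> R) :
  (forall i, smooth_on A (f i)) -> smooth_on A (fun x => \prod_(i <- s) f i x).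
Proof.
move=> Cf; elim: s => [|i s IH].
  by under eq_fun do rewrite big_nil; exact: smooth_cst.
by under eq_fun do rewrite big_cons; exact: smoothM.
Qed.

(** Induction on the order: the derivative of [1 / f] is [- (1 / f)^2 * f']. *)
Lemma smoothV f : (forall x, A x -> f x != 0) -> smooth_on A f ->
  smooth_on A (fun x => (f x)^-1).
Proof.
move=> f0 /smooth_onP Cf; apply/smooth_onP => k; move: (Cf k).
elim/ltn_ind: k => k IH; apply: (@cont_diff_chain k GRing.inv (fun y => - y^-1 ^+ 2)).
  move=> x Ax; apply: DeriveDef; first exact: (@derivableV _ _ id _ 1 (f0 x Ax)).
  rewrite [LHS](@deriveV _ _ id _ 1 (f0 x Ax)) ?derive_id //=.
  by rewrite [LHS]mulr1 [in RHS](exprVn (f x)).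
move=> l lk Cl /=; apply: cont_diff_eq oA _
  (cont_diffM (cont_diff_cst A l (-1)) (cont_diffM (IH l lk Cl) (IH l lk Cl))) => x Ax.
by rewrite /= mulN1r expr2.
Qed.

(** Induction on the order, with the derivative written
    [sqrt' y = sqrt y / (2 y)], in which [sqrt] occurs again. *)
Lemma smooth_sqrt f : (forall x, A x -> 0 < f x) -> smooth_on A f ->
  smooth_on A (fun x => Num.sqrt (f x)).
Proof.
move=> f0 Cf; have f0' x (Ax : A x) : f x != 0 by rewrite gt_eqF ?f0.
have /smooth_onP CV := smoothV f0' Cf.
move/smooth_onP: Cf => Cf; apply/smooth_onP => k; move: (Cf k).
elim/ltn_ind: k => k IH.
apply: (@cont_diff_chain k Num.sqrt (fun y => 2^-1 * (Num.sqrt y * y^-1))).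
  move=> x Ax; apply: is_derive_eq (is_derive1_sqrt (f0 x Ax)) _.
  rewrite -{3}[f x]sqr_sqrtr ?ltW ?f0// invfM expr2 invfM mulrA.
  by rewrite [RHS]mulrA mulfK // gt_eqF// sqrtr_gt0 f0.
move=> l lk Cl; apply: cont_diffM; first exact: cont_diff_cst.
by apply: cont_diffM; [exact: IH|exact: CV].
Qed.

Lemma smooth_sin_cos f : smooth_on A f ->
  smooth_on A (fun x => sin (f x)) /\ smooth_on A (fun x => cos (f x)).
Proof.
move=> /smooth_onP Cf.
suff H k : cont_diff A k (sin \o f) /\ cont_diff A k (cos \o f).
  by split; apply/smooth_onP => k; have [] := H k.
move: (Cf k); elim/ltn_ind: k => k IH Ck; split.
- apply: (@cont_diff_chain k sin cos) => // l lk Cl.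
  exact: (IH l lk Cl).2.
- apply: (@cont_diff_chain k cos (fun y => - sin y)) => // l lk Cl.
  apply: cont_diff_eq oA _ (cont_diffM (cont_diff_cst A l (-1)) (IH l lk Cl).1) => x _.
  by rewrite mulN1r.
Qed.

Lemma smooth_eq {W : normedModType R} (f g : 'rV[R]_n -> W) :
  (forall x, A x -> f x = g x) -> smooth_on A f -> smooth_on A g.
Proof.
move=> fg /smooth_onP Cf; apply/smooth_onP => k.
exact: cont_diff_eq oA fg (Cf k).
Qed.

Lemma smooth_pd {W : normedModType R} i (f : 'rV[R]_n -> W) :
  smooth_on A f -> smooth_on A (pd i f).
Proof.
move=> /smooth_onP Cf; apply/smooth_onP => k.
exact: (Cf k.+1).2.
Qed.

Lemma smooth_mx {p q} (M : 'rV[R]_n -> 'M[R]_(p, q)) :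
  (forall i j, smooth_on A (fun x => M x i j)) -> smooth_on A M.
Proof.
move=> CM; apply/smooth_onP => k.
have {}CM i j : cont_diff A k (fun x => M x i j) by have /smooth_onP := CM i j.
elim: k M CM => [|k IH] M CM; (split; [move=> x Ax|]); [|by []| |move=> i].
- by apply/differentiable_mxP => i j; exact: (cont_diff_differentiable (CM i j)).
- by apply/differentiable_mxP => i j; exact: (cont_diff_differentiable (CM i j)).
- apply: IH => a b; apply: cont_diff_eq oA _ ((CM a b).2 i) => x Ax.
  rewrite pd_mx//; apply/differentiable_mxP => c d.
  exact: (cont_diff_differentiable (CM c d)).
Qed.

Lemma smooth_entry {p q} (M : 'rV[R]_n -> 'M[R]_(p, q)) i j :
  smooth_on A M -> smooth_on A (fun x => M x i j).
Proof.
move=> /smooth_onP CM; apply/smooth_onP => k; move: (CM k).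
elim: k M {CM} => [|k IH] M [dM CM]; (split; [move=> x Ax|]); [|by []| |move=> l].
- by have /differentiable_mxP := dM x Ax; exact.
- by have /differentiable_mxP := dM x Ax; exact.
- apply: cont_diff_eq oA _ (IH _ (CM l)) => x Ax.
  by rewrite pd_mx//; exact: dM.
Qed.

Lemma smooth_mulmx {p q r} (M : 'rV[R]_n -> 'M[R]_(p, q)) (N : 'rV[R]_n -> 'M[R]_(q, r)) :
  smooth_on A M -> smooth_on A N -> smooth_on A (fun x => M x *m N x).
Proof.
move=> CM CN; apply: smooth_mx => i j; under eq_fun do rewrite mxE.
by apply: smooth_sum => k; apply: smoothM; exact: smooth_entry.
Qed.

Lemma smooth_det {p} (M : 'rV[R]_n -> 'M[R]_p) :
  smooth_on A M -> smooth_on A (fun x => \det (M x)).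
Proof.
move=> CM; rewrite /determinant; apply: smooth_sum => s.
by apply: smoothM; [exact: smooth_cst|apply: smooth_prod => i; exact: smooth_entry].
Qed.

(** Cramer's rule makes the entries of the inverse rational in those of [M]. *)
Lemma smooth_invmx {p} (M : 'rV[R]_n -> 'M[R]_p) :
  (forall x, A x -> M x \in unitmx) -> smooth_on A M -> smooth_on A (fun x => invmx (M x)).
Proof.
move=> uM CM; apply: (@smooth_eq _ (fun x => (\det (M x))^-1 *: \adj (M x))).
  by move=> x Ax; rewrite /invmx uM.
apply: smooth_mx => i j; under eq_fun do rewrite !mxE /cofactor.
apply: smoothM.
  apply: smoothV; last exact: smooth_det.
  by move=> x Ax; have := uM x Ax; rewrite unitmxE unitfE.
apply: smoothM; first exact: smooth_cst.
apply: smooth_det; apply: smooth_mx => a b; under eq_fun do rewrite !mxE.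
exact: smooth_entry.
Qed.

End OpenDomain.
End Smooth.

(** * Symmetry of second derivatives *)

Section Schwarz.
Context {R : realType} {V : normedModType R}.
Implicit Types (f : V -> R) (v w x y : V).

Lemma is_derive_line f v y (s : R) : differentiable f (y + s *: v) ->
  is_derive s 1 (fun h : R => f (y + h *: v)) ('D_v f (y + s *: v)).
Proof.
move=> df; pose line := fun h : R => y + h *: v.
have [dl dlE] : is_diff s line ( *:%R ^~ v).
  have := is_diffD (is_diff_cst y s) (is_diff_scalel s v).
  by congr is_diff_def; apply/funext => h; rewrite !fctE ?add0r.
have dfl : differentiable (f \o line) s by exact: differentiable_comp.
apply: DeriveDef; first exact/derivable1_diffP.
rewrite (deriveE _ dfl) diff_comp//=.
by rewrite dlE scale1r deriveE.
Qed.

(** The second difference of [f] along [v] and [w] is [h] times an increment of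
    [D_v f], by the mean value theorem applied to [s |-> f (x + h w + s v) -
    f (x + s v)]; the differential of [D_v f] at [x] then gives its leading term
    [h^2 D_w D_v f]. *)
Lemma second_difference f v w x (A : set V) (e : R) : open A -> A x ->
  (forall y, A y -> differentiable f y) -> differentiable ('D_v f) x -> 0 < e ->
  \forall h \near 0^'+, `|f (x + h *: w + h *: v) - f (x + h *: w) - f (x + h *: v) + f x
                  - h ^+ 2 * 'D_w ('D_v f) x| <= e * h ^+ 2.
Proof.
move=> oA Ax dfA dP e0; pose P : V -> R := 'D_v f.
(* [C h] bounds the sum of the lengths of the two displacements from [x] at which
   the remainder of [D_v f] is evaluated. *)
pose C := 2 * `|v| + `|w| + 1; have C0 : 0 < C.
  by rewrite /C; have := normr_ge0 v; have := normr_ge0 w; lra.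
have /nbhs_ballP[/= d1 d10 Ad1] := open_nbhs_nbhs (conj oA Ax).
have := diff_locally dP; rewrite -/P => /eqaddoP /(_ (e / C)).
rewrite divr_gt0// => /(_ isT)/nbhs_ballP[/= d2 d20 Pd2].
near=> h; have h0 : 0 < h by [].
have hd (d : R) : 0 < d -> h < d / C -> forall a b : R, `|a| <= h -> `|b| <= h ->
    `|a *: w + b *: v| < d.
  move=> dd0 hd a b ah bh; apply: le_lt_trans (ler_normD _ _) _; rewrite !normrZ.
  have : h * C < d by rewrite -ltr_pdivlMr.
  rewrite /C; have := ler_wpM2r (normr_ge0 w) ah; have := ler_wpM2r (normr_ge0 v) bh.
  have := mulr_ge0 (ltW h0) (normr_ge0 v); nra.
have h1 : h < d1 / C by near: h; apply: nbhs_right_lt; exact: divr_gt0.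
have h2 : h < d2 / C by near: h; apply: nbhs_right_lt; exact: divr_gt0.
have inA (a b : R) : `|a| <= h -> `|b| <= h -> A (x + a *: w + b *: v).
  move=> ah bh; apply: Ad1; rewrite -ball_normE /= -addrA opprD addNKr normrN.
  exact: hd.
have normh : `|h| <= h by rewrite ger0_norm// ltW.
have norm0 : `|0 : R| <= h by rewrite normr0 ltW.
pose psi (s : R) := f (x + h *: w + s *: v) - f (x + s *: v).
have dpsi (s : R) : `|s| <= h -> is_derive s 1 psi (P (x + h *: w + s *: v) - P (x + s *: v)).
  move=> sh; apply: is_deriveB; apply: is_derive_line; apply: dfA; first exact: inA.
  by have := inA 0 s norm0 sh; rewrite scale0r addr0.
have le_h (s : R) : s \in `]0, h[ -> `|s| <= h.
  by rewrite in_itv/= => /andP[s0 sh]; rewrite ger0_norm ltW.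
have [||s sI sE] := MVT h0 (f := psi)
    (df := fun s => P (x + h *: w + s *: v) - P (x + s *: v)).
- by move=> s /le_h /dpsi.
- apply: derivable_within_continuous => s; rewrite in_itv/= => /andP[s0 sh].
  by have [] := dpsi s _ => //; rewrite ger0_norm.
have Ps := le_h _ sI.
move: sE; rewrite /psi subr0 scale0r !addr0 => sE.
have -> : f (x + h *: w + h *: v) - f (x + h *: w) - f (x + h *: v) + f x =
    (P (x + h *: w + s *: v) - P (x + s *: v)) * h by rewrite -sE; ring.
have est (a b : R) : `|a| <= h -> `|b| <= h ->
    `|P (x + a *: w + b *: v) - P x - (a * 'D_w P x + b * 'D_v P x)| <= e / C * `|a *: w + b *: v|.
  move=> ah bh; have := Pd2 (a *: w + b *: v); rewrite -ball_normE /= sub0r normrN.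
  have dPl : 'd P x (a *: w + b *: v) = a * 'D_w P x + b * 'D_v P x.
    rewrite !deriveE//; rewrite raddfD; congr (_ + _); exact: linearZ.
  move=> /(_ (hd _ d20 h2 a b ah bh)); rewrite !fctE /= dPl.
  by rewrite opprD addrA [_ + x]addrC [x + (_ + _)]addrA.
have := est h s normh Ps; have := est 0 s norm0 Ps.
rewrite scale0r !add0r addr0 mul0r add0r => E1 E2.
have alg (a b c d q : R) : (a - b) * h - h ^+ 2 * c =
   h * ((a - d - (h * c + s * q)) - (b - d - s * q)) by ring.
rewrite (alg _ _ _ (P x) ('D_v P x)).
rewrite normrM (ger0_norm (ltW h0)) expr2 mulrCA ler_pM2l//.
apply: le_trans (ler_normB _ _) _; apply: le_trans (lerD E2 E1) _.
rewrite -mulrDr mulrAC ler_pdivrMr// -!mulrA ler_pM2l//.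
apply: le_trans (lerD (ler_normD _ _) (lexx _)) _; rewrite !normrZ.
rewrite /C; have := ler_wpM2r (normr_ge0 w) normh; have := ler_wpM2r (normr_ge0 v) Ps.
nra.
Unshelve. all: by end_near. Qed.

(** The second difference does not depend on the order of [v] and [w], and both
    mixed derivatives are its limit divided by [h^2]. *)
Theorem schwarz f v w x (A : set V) : open A -> A x ->
  (forall y, A y -> differentiable f y) ->
  differentiable ('D_v f) x -> differentiable ('D_w f) x ->
  'D_w ('D_v f) x = 'D_v ('D_w f) x.
Proof.
move=> oA Ax dfA dv dw; apply/eqP; rewrite -subr_eq0 -normr_le0.
apply/ler_addgt0Pr => e e0; rewrite add0r.
have e20 : 0 < e / 2 by rewrite divr_gt0.
have H1 := second_difference w oA Ax dfA dv e20.
have H2 := second_difference v oA Ax dfA dw e20.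
have [h [[E1 E2] h0]] := filter_ex (filterI (filterI H1 H2) (nbhs_right_gt 0)).
have h20 : 0 < h ^+ 2 by rewrite exprn_gt0.
rewrite -(ler_pM2l h20) -{1}(ger0_norm (ltW h20)) -normrM.
move: E1 E2; rewrite (addrAC x (h *: v)); set D := f _ => E1 E2.
have alg (a b c d p q : R) : h ^+ 2 * (p - q) =
   (a - c - b + d - h ^+ 2 * q) - (a - b - c + d - h ^+ 2 * p) by ring.
rewrite (alg D (f (x + h *: w)) (f (x + h *: v)) (f x)).
apply: le_trans (ler_normB _ _) _; apply: le_trans (lerD E2 E1) _.
by rewrite -mulrDl -splitr mulrC.
Qed.

End Schwarz.

Lemma pdC {R : realType} {n : nat} (A : set 'rV[R]_n) (f : 'rV[R]_n -> R) i j x :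
  open A -> smooth_on A f -> A x ->
  pd i (pd j f) x = pd j (pd i f) x.
Proof.
move=> oA sf Ax; rewrite !pd_partial; apply: (schwarz oA Ax).
- by move=> y Ay; exact: (sf [::]).
- exact: (sf [:: j]).
- exact: (sf [:: i]).
Qed.

(** * Submanifolds of Euclidean space *)

Lemma mulmx_trC {R : comNzRingType} {m n p : nat} (M : 'M[R]_(m, n)) (N : 'M[R]_(p, n)) i j :
  (M *m N^T) i j = (N *m M^T) j i.
Proof. by rewrite !mxE; apply: eq_bigr => a _; rewrite !mxE mulrC. Qed.

Section MatrixPartial.
Context {R : realType} {n : nat}.
Implicit Types (A : set 'rV[R]_n) (x : 'rV[R]_n).

Lemma smooth_differentiable {W : normedModType R} A (f : 'rV[R]_n -> W) x :
  smooth_on A f -> A x -> differentiable f x.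
Proof. by move=> sf Ax; exact: (sf [::]). Qed.

Lemma differentiable_mulmx {p q r} (M : 'rV[R]_n -> 'M[R]_(p, q))
    (N : 'rV[R]_n -> 'M[R]_(q, r)) x :
  differentiable M x -> differentiable N x -> differentiable (fun y => M y *m N y) x.
Proof.
move=> dM dN; apply/differentiable_mxP => i j; under eq_fun do rewrite mxE.
have dMNc c : differentiable (fun y => M y i c * N y c j) x.
  by apply: differentiableM; [exact: (differentiable_mxP M x).1|exact: (differentiable_mxP N x).1].
elim: (index_enum _) => [|c s IH].
  by under eq_fun do rewrite big_nil; exact: differentiable_cst.
by under eq_fun do rewrite big_cons; exact: differentiableD.
Qed.

Lemma pd_mulmx {p q r} k (M : 'rV[R]_n -> 'M[R]_(p, q)) (N : 'rV[R]_n -> 'M[R]_(q, r)) x :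
  differentiable M x -> differentiable N x ->
  pd k (fun y => M y *m N y) x = pd k M x *m N x + M x *m pd k N x.
Proof.
move=> dM dN.
have dMe a b : differentiable (fun y => M y a b) x by exact: (differentiable_mxP M x).1.
have dNe a b : differentiable (fun y => N y a b) x by exact: (differentiable_mxP N x).1.
have p_sum i j : pd k (fun y => \sum_c M y i c * N y c j) x =
     \sum_c (pd k (fun y => M y i c) x * N x c j + M x i c * pd k (fun y => N y c j) x).
  rewrite (pd_sum (index_enum 'I_q) k (fun c => differentiableM (dMe i c) (dNe c j))).2.
  by apply: eq_bigr => c _; exact: pdM.
have dMN := differentiable_mulmx dM dN.
apply/matrixP => i j; rewrite pd_mx//; under eq_fun do rewrite mxE.
rewrite p_sum !mxE -big_split; apply: eq_bigr => c _ /=.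
by rewrite !pd_mx.
Qed.

Lemma differentiable_tr {p q} (M : 'rV[R]_n -> 'M[R]_(p, q)) x :
  differentiable M x -> differentiable (fun y => (M y)^T) x.
Proof.
move=> dM; apply/differentiable_mxP => i j; under eq_fun do rewrite mxE.
exact: (differentiable_mxP M x).1.
Qed.

Lemma smooth_tr {p q} A (M : 'rV[R]_n -> 'M[R]_(p, q)) :
  open A -> smooth_on A M -> smooth_on A (fun y => (M y)^T).
Proof.
move=> oA sM; apply: smooth_mx => // i j; under eq_fun do rewrite mxE.
exact: smooth_entry.
Qed.

Lemma pd_trmx {p q} k (M : 'rV[R]_n -> 'M[R]_(p, q)) x :
  differentiable M x -> pd k (fun y => (M y)^T) x = (pd k M x)^T.
Proof.
move=> dM; have dMe := (differentiable_mxP M x).1 dM.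
apply/matrixP => i j; rewrite mxE !pd_mx//.
  by under eq_fun do rewrite mxE.
exact: differentiable_tr.
Qed.

Lemma smooth_jac {m} A (f : 'rV[R]_n -> 'rV[R]_m) :
  open A -> smooth_on A f -> smooth_on A (fun x => jac f x).
Proof.
move=> oA sf; apply: smooth_mx => // i j.
apply: (@smooth_eq _ _ _ oA _ (pd i (fun y => f y 0 j))).
  by move=> x Ax; rewrite jac_pd//; exact: smooth_differentiable Ax.
by apply: smooth_pd => //; exact: smooth_entry.
Qed.

End MatrixPartial.

Section Immersion.
Context {R : realType} {n m : nat}.
Variables (A : set 'rV[R]_n) (Phi : 'rV[R]_n -> 'rV[R]_m) (g : 'rV[R]_n -> 'M[R]_n).
Hypotheses (oA : open A) (sPhi : smooth_on A Phi).
Hypothesis gE : forall x, A x -> g x = jac Phi x *m (jac Phi x)^T.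
Hypothesis g_unit : forall x, A x -> g x \in unitmx.

Let D x := jac Phi x.

Let sD : smooth_on A D. Proof. exact: smooth_jac. Qed.

Let dD x : A x -> differentiable D x. Proof. exact: smooth_differentiable. Qed.

(** The Levi-Civita connection form along the [k]-th coordinate vector:
    [nabla_k d_i = \sum_l (connection g k x) i l d_l]. *)
Definition connection (h : 'rV[R]_n -> 'M[R]_n) k x : 'M[R]_n :=
  \matrix_(i, l) christoffel h l k i x.

(** This is the symmetry of the second derivatives of [Phi]. *)
Lemma pd_jacC i j x : A x -> row i (pd j D x) = row j (pd i D x).
Proof.
move=> Ax; apply/rowP => a; rewrite !mxE !pd_mx; try exact: dD.
pose f y := Phi y 0 a.
have DE k y : A y -> D y k a = pd k f y.
  by move=> Ay; rewrite /D jac_pd//; exact: smooth_differentiable Ay.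
rewrite (pd_eq_on _ oA (DE i))// (pd_eq_on _ oA (DE j))//.
by apply: pdC Ax => //; exact: smooth_entry.
Qed.

Lemma pd_metric k x : A x ->
  pd k g x = pd k D x *m (D x)^T + D x *m (pd k D x)^T.
Proof.
move=> Ax; rewrite (pd_eq_on _ oA gE)// -/D -pd_trmx; last exact: dD.
apply: pd_mulmx; first exact: dD.
exact: differentiable_tr (dD Ax).
Qed.

Lemma smooth_metric : smooth_on A g.
Proof.
apply: (smooth_eq oA (fun y Ay => esym (gE Ay))).
by apply: smooth_mulmx => //; exact: smooth_tr.
Qed.

(** In the Christoffel symbol the six scalar products of a second and a first
    derivative of [Phi] cancel up to two equal ones, because second derivatives
    commute: [Gamma_kij = <d_k d_i Phi, d_j Phi>]. *)
Lemma connectionE k x : A x ->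
  connection g k x = pd k D x *m (D x)^T *m invmx (g x).
Proof.
move=> Ax.
have dg := smooth_differentiable smooth_metric Ax.
pose T k := pd k D x *m (D x)^T.
have TC i j l : T i j l = T j i l.
  rewrite !mxE; apply: eq_bigr => a _.
  by have /rowP/(_ a) := pd_jacC j i Ax; rewrite !mxE => ->.
have gsym : (g x)^T = g x by rewrite gE// trmx_mul trmxK.
have igsym i j : invmx (g x) i j = invmx (g x) j i.
  by rewrite -{1}gsym -trmx_inv mxE.
have dgE k' i j : pd k' (fun y => g y i j) x = T k' i j + T k' j i.
  rewrite -pd_mx// pd_metric// mxE; congr (_ + _).
  by rewrite mulmx_trC.
apply/matrixP => i l; rewrite [LHS]mxE /christoffel [RHS]mxE mulr_sumr; apply: eq_bigr => p _.
rewrite -!pd_partial.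
rewrite !dgE -/(T k) (igsym l p) (TC i k p) (TC p k i) (TC p i k).
by field.
Qed.

Lemma christoffelC k l i x : A x -> christoffel g l k i x = christoffel g l i k x.
Proof.
move=> Ax; have E a b : christoffel g l a b x = connection g a x b l by rewrite mxE.
rewrite !E !connectionE// -!mulmxA !mxE; apply: eq_bigr => a _.
by have /rowP/(_ a) := pd_jacC i k Ax; rewrite !mxE => ->.
Qed.

Lemma smooth_connection k : smooth_on A (connection g k).
Proof.
have sg := smooth_metric.
apply: (smooth_eq oA (fun x Ax => esym (connectionE k Ax))).
apply: smooth_mulmx => //; last exact: smooth_invmx.
apply: smooth_mulmx => //; first exact: smooth_pd.
exact: smooth_tr.
Qed.

End Immersion.

Section FlatKaehler.
Context {R : realType} {n : nat}.
Variables (A L : set 'rV[R]_n) (Phi : 'rV[R]_n -> 'rV[R]_n) (g : 'rV[R]_n -> 'M[R]_n).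
Hypotheses (oA : open A) (sPhi : smooth_on A Phi).
Hypothesis gE : forall x, A x -> g x = jac Phi x *m (jac Phi x)^T.
Hypothesis g_unit : forall x, A x -> g x \in unitmx.

Lemma jac_unit x : A x -> jac Phi x \in unitmx.
Proof. by move=> Ax; have := g_unit Ax; rewrite gE// unitmx_mul => /andP[]. Qed.

(** When the Jacobian is invertible, the second derivatives of [Phi] have no
    normal part: the coordinate vector fields are transported by the flat
    connection. *)
Lemma pd_jac_flat k x : A x ->
  pd k (fun y => jac Phi y) x = connection g k x *m jac Phi x.
Proof.
move=> Ax; have uD := jac_unit Ax.
have uDT : (jac Phi x)^T \in unitmx by rewrite unitmx_tr.
rewrite (connectionE oA sPhi gE k Ax) gE//.
have -> : invmx (jac Phi x *m (jac Phi x)^T) = invmx (jac Phi x)^T *m invmx (jac Phi x).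
  have uP : jac Phi x *m (jac Phi x)^T \in unitmx by rewrite unitmx_mul uD.
  apply: (row_full_inj (A := jac Phi x *m (jac Phi x)^T)); first by rewrite row_full_unit.
  by rewrite mulmxV// mulmxA mulmxK// mulmxV.
by rewrite -!mulmxA mulVmx// mulmx1 mulmxV// mulmx1.
Qed.

(** A local isometry [Phi] to Euclidean space pulls a constant orthogonal complex
    structure [J0] back to [J]: differentiating [J * jac Phi = jac Phi * J0] and
    replacing the derivatives of [jac Phi] by the connection gives that [J] is
    parallel. *)
Theorem kaehler_of_flat (J : 'rV[R]_n -> 'M[R]_n) (J0 : 'M[R]_n) :
  J0 *m J0 = - 1%:M -> J0 *m J0^T = 1%:M ->
  smooth_on A J -> (forall x v, A x -> L v -> J (x + v) = J x) ->
  (forall x, A x -> J x *m jac Phi x = jac Phi x *m J0) ->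
  kaehler A L g.
Proof.
move=> JJ JJT sJ JL JD; exists J.
have inj x (Ax : A x) (M N : 'M[R]_n) : M *m jac Phi x = N *m jac Phi x -> M = N.
  by move=> /(congr1 (mulmxr (invmx (jac Phi x)))) /=; rewrite !mulmxK// jac_unit.
split=> // x Ax.
- apply: (inj x Ax); rewrite -mulmxA JD// mulmxA JD// -mulmxA JJ.
  by rewrite mulmxN mulNmx mulmx1 mul1mx.
- rewrite gE// !mulmxA JD// -!mulmxA -trmx_mul JD// trmx_mul !mulmxA.
  by rewrite -(mulmxA _ J0) JJT mulmx1.
have dJ := smooth_differentiable sJ Ax.
have dD := smooth_differentiable (smooth_jac oA sPhi) Ax.
have parallel k : pd k J x + J x *m connection g k x - connection g k x *m J x = 0.
  apply: (inj x Ax); rewrite mul0mx mulmxBl mulmxDl -!mulmxA JD//.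
  rewrite -pd_jac_flat// mulmxA -pd_jac_flat//.
  apply/eqP; rewrite subr_eq0; apply/eqP; rewrite -pd_mulmx//.
  rewrite (pd_eq_on k oA JD Ax) pd_mulmx//.
  by rewrite (_ : pd k (fun=> J0) x = 0) ?mulmx0 ?addr0//; exact: pd_cst.
move=> k i j; have /matrixP/(_ i j) := parallel k; rewrite !mxE pd_mx// pd_partial => H.
apply: etrans H; congr (_ + _ - _); apply: eq_bigr => l _; by rewrite mxE.
Qed.

End FlatKaehler.

Section Gauss.
Context {R : realType} {n : nat}.
Variables (A : set 'rV[R]_n) (Phi : 'rV[R]_n -> 'rV[R]_(1 + n)) (g : 'rV[R]_n -> 'M[R]_n).
Hypotheses (oA : open A) (sPhi : smooth_on A Phi).
Hypothesis gE : forall x, A x -> g x = jac Phi x *m (jac Phi x)^T.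
Hypothesis g_unit : forall x, A x -> g x \in unitmx.
Hypothesis Phi_unit : forall x, A x -> Phi x *m (Phi x)^T = 1%:M.

Let D x := jac Phi x.
Let sD : smooth_on A D. Proof. exact: smooth_jac. Qed.
Let dD x : A x -> differentiable D x. Proof. exact: smooth_differentiable. Qed.
Let dPhi x : A x -> differentiable Phi x. Proof. exact: smooth_differentiable. Qed.

Lemma pd_row k x : A x -> pd k Phi x = row k (D x).
Proof.
move=> Ax; apply/rowP => a; rewrite mxE /D jac_pd//; last exact: dPhi.
by rewrite pd_mx//; exact: dPhi.
Qed.

(** Differentiating [<Phi, Phi> = 1]. *)
Lemma sphere_normal x : A x -> D x *m (Phi x)^T = 0.
Proof.
move=> Ax; apply/row_matrixP => k; rewrite row0 row_mul -pd_row//.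
have := pd_eq_on k oA Phi_unit Ax.
rewrite pd_mulmx//; [|exact: dPhi|exact: differentiable_tr (dPhi Ax)].
rewrite pd_trmx; last exact: dPhi.
rewrite (_ : pd k (fun=> 1%:M) x = 0); last exact: pd_cst.
move=> /matrixP/(_ 0 0).
have E : (Phi x *m (pd k Phi x)^T) 0 0 = (pd k Phi x *m (Phi x)^T) 0 0.
  exact: mulmx_trC.
rewrite mxE E [RHS]mxE => /eqP; rewrite -mulr2n mulrn_eq0/= => /eqP E0.
by apply/matrixP => i j; rewrite !ord1 E0 mxE.
Qed.

(** Differentiating [<d_i Phi, Phi> = 0]. *)
Lemma sphere_second_normal k x : A x ->
  pd k D x *m (Phi x)^T = - col k (g x).
Proof.
move=> Ax; apply/eqP; rewrite -addr_eq0; apply/eqP.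
have := pd_eq_on k oA sphere_normal Ax.
rewrite pd_mulmx//; [|exact: dD|exact: differentiable_tr (dPhi Ax)].
rewrite pd_trmx; last exact: dPhi.
rewrite (_ : pd k (fun=> 0) x = 0); last exact: pd_cst.
by rewrite pd_row// gE// -/(D x) tr_row colE mulmxA -colE.
Qed.

(** The position vector is the unit normal, and the second fundamental form is
    [- g]. The difference of the two sides is orthogonal to the frame that consists
    of [Phi] and its derivatives. *)
Lemma gauss_formula k x : A x ->
  pd k D x = connection g k x *m D x - col k (g x) *m Phi x.
Proof.
move=> Ax; pose w := pd k D x - (connection g k x *m D x - col k (g x) *m Phi x).
apply/eqP; rewrite -subr_eq0 -/w; apply/eqP.
pose E := col_mx (Phi x) (D x).
have DP := sphere_normal Ax.
have PD : Phi x *m (D x)^T = 0 by rewrite -[LHS]trmxK trmx_mul trmxK DP trmx0.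
have uE : E^T \in unitmx.
  have : E *m E^T \in unitmx.
    rewrite /E tr_col_mx mul_col_row Phi_unit// DP PD -gE//.
    by rewrite unitmxE det_ublock det1 mul1r -unitmxE g_unit.
  by rewrite unitmx_mul => /andP[].
suff wE : w *m E^T = 0 by rewrite -[w](mulmxK uE) wE mul0mx.
rewrite /E tr_col_mx mul_mx_row -[RHS]row_mx0; congr row_mx.
  rewrite /w mulmxBl sphere_second_normal// mulmxBl -!mulmxA DP Phi_unit//.
  by rewrite mulmx0 mulmx1 sub0r subrr.
rewrite /w !mulmxBl -!mulmxA PD mulmx0 subr0 -gE//.
by rewrite (connectionE oA sPhi gE k Ax) mulmxKV// ?subrr// g_unit.
Qed.

(** Differentiating Gauss' formula and projecting to the tangent space. *)
Lemma pd_gauss j k x : A x ->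
  pd j (pd k D) x *m (D x)^T =
  (pd j (connection g k) x + connection g k x *m connection g j x
   - col k (g x) *m delta_mx 0 j) *m g x.
Proof.
move=> Ax; have sG := smooth_connection oA sPhi gE g_unit.
have dG := smooth_differentiable (sG k) Ax.
have dcol : differentiable (fun y => col k (g y)) x.
  apply/differentiable_mxP => a b; under eq_fun do rewrite mxE.
  by move: a b => a _; apply: (differentiable_mxP g x).1; exact: smooth_differentiable (smooth_metric oA sPhi gE) Ax.
have PD : Phi x *m (D x)^T = 0 by rewrite -[LHS]trmxK trmx_mul trmxK sphere_normal ?trmx0.
have DDT i : pd i D x *m (D x)^T = connection g i x *m g x.
  by rewrite (connectionE oA sPhi gE)// mulmxKV ?g_unit.
rewrite (pd_eq_on j oA (gauss_formula k) Ax) pdB; last 2 first.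
- by apply: differentiable_mulmx => //; exact: dD.
- by apply: differentiable_mulmx => //; exact: dPhi.
rewrite !pd_mulmx//; [|exact: dPhi|exact: dD].
rewrite pd_row// mulmxBl !mulmxDl -!mulmxA DDT PD mulmx0 add0r.
rewrite mulNmx -!mulmxA rowE -mulmxA -(gE Ax).
by [].
Qed.

(** The left-hand side of [pd_gauss] is symmetric in [j] and [k]. This is the
    Gauss equation: the curvature tensor is that of constant curvature one. *)
Lemma riemann_sphere j k x : A x ->
  pd j (connection g k) x + connection g k x *m connection g j x
    - col k (g x) *m delta_mx 0 j =
  pd k (connection g j) x + connection g j x *m connection g k x
    - col j (g x) *m delta_mx 0 k.
Proof.
move=> Ax; have ug := g_unit Ax.
suff E : pd j (pd k D) x = pd k (pd j D) x.
  have := pd_gauss j k Ax; rewrite E pd_gauss//.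
  by move=> /(congr1 (mulmxr (invmx (g x)))) /=; rewrite !mulmxK.
apply/matrixP => a b.
have dpD i : differentiable (pd i D) x.
  by apply: smooth_differentiable Ax; exact: smooth_pd.
rewrite !pd_mx//.
have pE i y : A y -> pd i D y a b = pd i (fun z => D z a b) y.
  by move=> Ay; rewrite pd_mx//; exact: dD.
rewrite (pd_eq_on j oA (pE k) Ax) (pd_eq_on k oA (pE j) Ax).
by apply: (pdC _ _ oA) => //; exact: smooth_entry.
Qed.

(** The contraction of [g_ij delta_kl - g_ik delta_jl] over [k = l] is
    [(n - 1) g_ij]. *)
Theorem einstein_of_sphere : einstein A g (n%:R - 1).
Proof.
move=> x Ax; have sG := smooth_connection oA sPhi gE g_unit.
have dG k := smooth_differentiable (sG k) Ax.
have CE k i l y : christoffel g l k i y = connection g k y i l by rewrite mxE.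
have pCE j k i l : pd j (christoffel g l k i) x = pd j (connection g k) x i l.
  rewrite pd_mx//; congr (pd j _ x); apply/funext => y; exact: CE.
have C0 := christoffelC oA sPhi gE.
apply/matrixP => i j; rewrite !mxE.
have C1 a b l : pd a (christoffel g l i b) x = pd a (christoffel g l b i) x.
  by apply: pd_eq_on Ax => // y Ay; exact: C0.
have outer (u v k : 'I_n) : (col u (g x) *m delta_mx 0 v : 'M[R]_n) i k = g x i u * (k == v)%:R.
  by rewrite mxE big_ord1 !mxE eqxx.
have entry3 (M N P : 'M[R]_n) a b : (M + N - P) a b = M a b + N a b - P a b.
  by rewrite !mxE.
have Rk k : pd k (christoffel g k i j) x - pd j (christoffel g k i k) x
    + \sum_l (christoffel g k k l x * christoffel g l i j x
              - christoffel g k j l x * christoffel g l i k x)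
    = g x i j - g x i k * (k == j)%:R.
  have /matrixP/(_ i k) := riemann_sphere k j Ax.
  rewrite C1 (C1 j) !pCE sumrB.
  have -> : \sum_l christoffel g k k l x * christoffel g l i j x =
            (connection g j x *m connection g k x) i k.
    by rewrite [RHS]mxE; apply: eq_bigr => l _; rewrite (C0 i l)// !CE mulrC.
  have -> : \sum_l christoffel g k j l x * christoffel g l i k x =
            (connection g k x *m connection g j x) i k.
    by rewrite [RHS]mxE; apply: eq_bigr => l _; rewrite (C0 i l)// !CE mulrC.
  rewrite !entry3 !outer eqxx mulr1.
  set G1 := fun_of_matrix _ i k; set G2 := fun_of_matrix (pd j _ _) i k.
  set M1 := (_ *m _ : 'M[R]_n) i k; set M2 := (_ *m _ : 'M[R]_n) i k; lra.
apply: (@etrans _ _ (\sum_k (g x i j - g x i k * (k == j)%:R))).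
  rewrite -(eq_bigr _ (fun k _ => Rk k)) big_split sumrB; congr (_ - _ + _).
    by apply: eq_bigr => k _; rewrite pd_partial.
  by apply: eq_bigr => k _; rewrite pd_partial.
rewrite sumrB sumr_const card_ord.
rewrite (bigD1 j)//= eqxx mulr1 big1 => [|k /negPf ->]; last by rewrite mulr0.
by rewrite addr0 mulrBl mul1r mulr_natl.
Qed.

End Gauss.

(** * Orbits and polar coordinates *)

Section OrbitSpace.
Local Open Scope quotient_scope.
Context {R : realType} {M : set 'rV[R]_(3 + 3)}.
Implicit Types p q : M.

Lemma orbit_projP p q :
  orbit_proj p = orbit_proj q <-> exists k, set_val q = iter k generator (set_val p).
Proof.
split=> [|[k qE]].
  by move=> /eqmodP /orbit_relP.
by apply/eqmodP/orbit_relP; exists k.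
Qed.

Lemma orbit_proj_surj (u : orbit_space M) : exists p, u = orbit_proj p.
Proof. by exists (repr u); rewrite /orbit_proj reprK. Qed.


Lemma open_orbit_space (O : set (orbit_space M)) :
  open O <-> exists2 V : set 'rV[R]_(3 + 3), open V & (@orbit_proj _ M) @^-1` O = set_val @^-1` V.
Proof. by split=> -[V oV VE]; exists V. Qed.

End OrbitSpace.

Section Polar.
Local Open Scope complex_scope.
Context {R : realType}.
Implicit Types (a b A B : 'rV[R]_3) (p q : 'rV[R]_(3 + 3)).

(** The point of [C^3] with moduli [A] and arguments [a]. *)
Definition polar A a : 'rV[R]_(3 + 3) :=
  row_mx (\row_j (A 0 j * cos (a 0 j))) (\row_j (A 0 j * sin (a 0 j))).

Lemma ord3P (j : 'I_3) : j = 0 \/ j = 1 \/ j = 2.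
Proof.
by case: j => [[|[|[|//]]] ?]; [left|right; left|right; right]; apply: val_inj.
Qed.

(** The squared modulus of the [j]-th complex coordinate. *)
Definition sqnorm p j : R := p 0 (lshift 3 j) ^+ 2 + p 0 (rshift 3 j) ^+ 2.

Lemma sqnorm_polar A a j : sqnorm (polar A a) j = A 0 j ^+ 2.
Proof.
rewrite /sqnorm row_mxEl row_mxEr !mxE !exprMn -mulrDr cos2Dsin2 mulr1.
by [].
Qed.

Lemma S5E p : S5 p <-> \sum_j sqnorm p j = 1.
Proof.
rewrite /S5 /= (eq_bigr (fun j => (sqnorm p j)%:C)) => [|j _]; last first.
  by rewrite mxE normc_def -rmorphXn /= sqr_sqrtr ?addr_ge0 ?sqr_ge0.
rewrite -rmorph_sum.
by split=> [/complexI//|->].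
Qed.

Lemma generatorE p : generator p =
  row_mx (\row_j [:: - p 0 (rshift 3 0); - p 0 (rshift 3 1); - p 0 (lshift 3 2)]`_j)
         (\row_j [:: p 0 (lshift 3 0); p 0 (lshift 3 1); - p 0 (rshift 3 2)]`_j).
Proof.
by congr row_mx; apply/rowP => -[[|[|[|//]]] lt_j]; rewrite !mxE /= ?mxE /=; ring.
Qed.

(** The arguments of the weights [i], [i], [-1] of the generator of [Z_4]. *)
Definition generator_angle : 'rV[R]_3 := \row_j [:: pi / 2; pi / 2; pi]`_j.

Lemma generator_polar A a : generator (polar A a) = polar A (a + generator_angle).
Proof.
have cDpi (x : R) : cos (x + pi) = - cos x by rewrite cosDpi.
have sDpi (x : R) : sin (x + pi) = - sin x by rewrite sinDpi.
rewrite generatorE /polar !row_mxEl !row_mxEr !mxE.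
congr row_mx; apply/rowP => -[[|[|[|//]]] lt_j]; rewrite !mxE /=;
  rewrite ?cosDpihalf ?sinDpihalf ?cDpi ?sDpi ?mulrN //;
  do ?congr (- _); by congr (A 0 _ * _ (a 0 _)); apply: val_inj.
Qed.

Lemma iter_generator_polar k A a :
  iter k generator (polar A a) = polar A (a + generator_angle *+ k).
Proof.
elim: k => [|k IH]; first by rewrite addr0.
by rewrite iterS IH generator_polar -addrA -mulrSr.
Qed.

Lemma generator_scale (r : R) p : generator (r *: p) = r *: generator p.
Proof.
rewrite !generatorE scale_row_mx.
by congr row_mx; apply/rowP => -[[|[|[|//]]] lt_j]; rewrite !mxE /=; ring.
Qed.

Lemma sqnorm_generator p j : sqnorm (generator p) j = sqnorm p j.
Proof.
rewrite /sqnorm generatorE row_mxEl row_mxEr !mxE.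
by have [->|[->| ->]] := ord3P j; rewrite /= !sqrrN // addrC.
Qed.

Lemma periodic_int (f : R -> R) (T x : R) (k : int) : periodic f T ->
  f (x + T * k%:~R) = f x.
Proof.
move=> fT; case: k => n; first by rewrite mulr_natr periodicn.
rewrite NegzE mulrNz mulrN mulr_natr -[in RHS](subrK (T *+ n.+1) x).
by rewrite [RHS](periodicn fT).
Qed.

Lemma cosDz2pi (x : R) (k : int) : cos (x + 2 * pi * k%:~R) = cos x.
Proof. by apply: periodic_int => y; rewrite mulr_natl cosD2pi. Qed.

Lemma sinDz2pi (x : R) (k : int) : sin (x + 2 * pi * k%:~R) = sin x.
Proof. by apply: periodic_int => y; rewrite mulr_natl sinD2pi. Qed.

(** Subtracting from [y - x] its integral multiple of [2 pi] leaves an angle [e] in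
    [[0, 2 pi)] with [cos e = 1], that is, [sin (e / 2) = 0]. *)
Lemma angle_eq (x y : R) : cos x = cos y -> sin x = sin y ->
  exists k : int, y - x = 2 * pi * k%:~R.
Proof.
move=> cxy sxy; have pi0 : 0 < 2 * pi :> R by rewrite mulr_gt0// pi_gt0.
pose k := Num.floor ((y - x) / (2 * pi)); exists k.
pose e := y - x - 2 * pi * k%:~R.
have /andP[lek ltk] : (k%:~R <= (y - x) / (2 * pi) < (k + 1)%:~R).
  exact: Num.Theory.floor_itv.
have e_ge0 : 0 <= e by move: lek; rewrite /e subr_ge0 ler_pdivlMr// mulrC.
have e_lt : e < 2 * pi.
  by move: ltk; rewrite ltr_pdivrMr// intrD mulrDl mul1r /e mulrC; lra.
have ce : cos e = 1.
  have -> : e = y - x + 2 * pi * (- k)%:~R by rewrite /e mulrNz mulrN.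
  by rewrite cosDz2pi cosB -cxy -sxy -!expr2 cos2Dsin2.
have [e0|e_neq0] := eqVneq e 0.
  by apply/eqP; rewrite -subr_eq0 -/e e0.
have s_gt0 : 0 < sin (e / 2).
  have e_gt0 : 0 < e by rewrite lt_neqAle eq_sym e_neq0.
  apply: sin_gt0_pi; rewrite divr_gt0//=.
  by rewrite ltr_pdivrMr// mulrC.
have : cos e = 1 - 2 * sin (e / 2) ^+ 2.
  have {1}-> : e = (e / 2) *+ 2 by rewrite -mulr_natr divfK.
  by rewrite cos_mulr2n cos2sin2; ring.
have := exprn_gt0 2 s_gt0; rewrite ce; lra.
Qed.

Lemma angle_exists (u v : R) : u ^+ 2 + v ^+ 2 = 1 -> exists x, u = cos x /\ v = sin x.
Proof.
move=> uv; have u1 : -1 <= u <= 1.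
  by have := sqr_ge0 v; have := sqr_ge0 (u - 1); have := sqr_ge0 (u + 1); nra.
have sv : sin (acos u) = `|v| by rewrite sin_acos// -uv addrC addKr sqrtr_sqr.
have [v0|v0] := leP 0 v.
  by exists (acos u); rewrite acosK// sv ger0_norm.
by exists (- acos u); rewrite cosN sinN acosK// sv ltr0_norm// opprK.
Qed.

Lemma polar_shift A a b : (forall j, exists k : int, b 0 j - a 0 j = 2 * pi * k%:~R) ->
  polar A a = polar A b.
Proof.
move=> ab; have E j : exists k : int, b 0 j = a 0 j + 2 * pi * k%:~R.
  by have [k kE] := ab j; exists k; rewrite -kE addrC subrK.
by congr row_mx; apply/rowP => j; rewrite !mxE; have [k ->] := E j;
  rewrite ?cosDz2pi ?sinDz2pi.
Qed.

Lemma polar_inj A B a b : (forall j, 0 < A 0 j) -> (forall j, 0 < B 0 j) ->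
  polar A a = polar B b ->
  A = B /\ forall j, exists k : int, b 0 j - a 0 j = 2 * pi * k%:~R.
Proof.
move=> A0 B0 E; have AB j : A 0 j = B 0 j.
  have := sqnorm_polar A a j; rewrite E sqnorm_polar => /eqP.
  by rewrite eqrXn2 ?ltW// => /eqP.
split=> [|j]; first exact/rowP.
have nA : A 0 j != 0 by rewrite gt_eqF.
have /rowP E' := E; apply: angle_eq; apply: (mulfI nA).
  by have := E' (lshift 3 j); rewrite !row_mxEl !mxE AB.
by have := E' (rshift 3 j); rewrite !row_mxEr !mxE AB.
Qed.

Lemma polar_surj p : (forall j, 0 < sqnorm p j) ->
  exists A a, (forall j, 0 < A 0 j) /\ p = polar A a.
Proof.
move=> p0; pose A : 'rV[R]_3 := \row_j Num.sqrt (sqnorm p j).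
have A0 j : 0 < A 0 j by rewrite mxE sqrtr_gt0.
have A2 j : A 0 j ^+ 2 = sqnorm p j by rewrite mxE sqr_sqrtr// ltW.
have ex j : {x | p 0 (lshift 3 j) = A 0 j * cos x /\ p 0 (rshift 3 j) = A 0 j * sin x}.
  apply: cid; have nA : A 0 j != 0 by rewrite gt_eqF.
  have [|x [cx sx]] := @angle_exists (p 0 (lshift 3 j) / A 0 j) (p 0 (rshift 3 j) / A 0 j).
    by rewrite !expr_div_n -mulrDl -/(sqnorm p j) A2 divff ?gt_eqF.
  by exists x; rewrite -cx -sx; split; rewrite mulrC divfK.
exists A, (\row_j sval (ex j)); split=> //; apply/rowP => i.
case: (split_ordP i) => j ->; rewrite ?row_mxEl ?row_mxEr !mxE; case: (ex j) => x /= [E1 E2].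
  by rewrite E1 mxE.
by rewrite E2 mxE.
Qed.

End Polar.

(** * The open dense part of the quotients *)

Section RegularPart.
Context {R : realType}.
Implicit Types (p q : 'rV[R]_(3 + 3)) (V : set 'rV[R]_(3 + 3)).

(** The points of [C^3] all of whose coordinates are nonzero. *)
Definition regular : set 'rV[R]_(3 + 3) := [set p | forall j, 0 < sqnorm p j].

Lemma sqnorm_continuous j : continuous (sqnorm ^~ j : 'rV[R]_(3 + 3) -> R).
Proof.
move=> p; suff : differentiable (sqnorm ^~ j : 'rV[R]_(3 + 3) -> R) p.
  exact: differentiable_continuous.
have dc k : differentiable (fun q : 'rV[R]_(3 + 3) => q 0 k) p.
  exact: differentiable_coord.
rewrite /sqnorm; under eq_fun do rewrite !expr2.
set l := lshift 3 j; set r := rshift 3 j.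
exact: (differentiableD (differentiableM (dc l) (dc l)) (differentiableM (dc r) (dc r))).
Qed.

Lemma open_regular : open regular.
Proof.
pose U j := [set p : 'rV[R]_(3 + 3) | 0 < sqnorm p j].
have oU j : open (U j).
  by apply: open_comp (@open_gt R 0) => p _; exact: sqnorm_continuous.
have -> : regular = U 0 `&` (U 1 `&` U 2).
  apply/seteqP; split=> p; first by move=> rp; do !split; exact: rp.
  by move=> [U0 [U1 U2]] j; have [->|[->| ->]] := ord3P j.
by apply: openI => //; exact: openI.
Qed.

(** Moving the real parts away from zero, all at the same speed, makes every
    coordinate nonzero at once. *)
Lemma regular_dense V p : open V -> V p -> exists2 q, V q & regular q.
Proof.
move=> oV Vp.
pose s j : R := if 0 <= p 0 (lshift 3 j) then 1 else -1.
pose w : 'rV[R]_(3 + 3) := row_mx (\row_j s j) 0.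
pose q (e : R) := p + e *: w.
have qc : q e @[e --> (0 : R)] --> p.
  rewrite -[X in _ --> X]addr0 -(scale0r w).
  by apply: cvgD; [exact: cvg_cst|exact: scalel_continuous].
have nV : \forall e \near (0 : R)^'+, V (q e).
  by apply: (cvg_at_right_filter qc); exact: open_nbhs_nbhs.
have nV0 : \forall e \near (0 : R)^'+, V (q e) /\ 0 < e.
  by near=> e; split; [near: e|].
have [|e [Ve e0]] := filter_ex nV0; first exact: at_right_proper_filter.
exists (q e) => // j; rewrite /sqnorm addrC ltr_wpDl ?sqr_ge0//.
rewrite mxE [X in _ + X]mxE row_mxEl mxE exprn_even_gt0//= /s.
case: ifPn => [p0|]; first by rewrite mulr1 gt_eqF// ltr_wpDl.
by rewrite -ltNge => p0; rewrite mulrN1 lt_eqF// subr_lt0 (lt_trans p0).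
Unshelve. all: by end_near. Qed.

Lemma sqnorm_scale (r : R) p j : sqnorm (r *: p) j = r ^+ 2 * sqnorm p j.
Proof. by rewrite /sqnorm !mxE !exprMn mulrDr. Qed.

(** Radial projection is continuous at [p], so that a regular point near [p] in
    [C^3] projects to one near [p] on the sphere. *)
Lemma sphere_regular_dense V p : open V -> V p -> S5 p ->
  exists q, [/\ V q, regular q & S5 q].
Proof.
move=> oV Vp /S5E p1; pose N q := \sum_j sqnorm q j.
pose f q := (Num.sqrt (N q))^-1 *: q.
have N_cont : continuous N.
  by apply: continuous_big => [|j _]; [exact: add_continuous|exact: sqnorm_continuous].
have fp : f p = p by rewrite /f /N p1 sqrtr1 invr1 scale1r.
have f_cont : {for p, continuous f}.
  apply: continuousZ; last exact: cvg_id.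
  apply: continuousV; first by rewrite /N p1 sqrtr1 oner_neq0.
  apply: continuous_comp; first exact: N_cont.
  exact: sqrt_continuous.
have : nbhs p (f @^-1` V) by apply: f_cont; rewrite fp; exact: open_nbhs_nbhs.
rewrite nbhsE => -[W [oW Wp] WV].
have [q Wq rq] := regular_dense oW Wp.
have Nq : 0 < N q by rewrite /N (bigD1 0)//= ltr_wpDr ?sumr_ge0// => j _; exact: ltW.
exists (f q); split; first exact: WV.
  by move=> j; rewrite sqnorm_scale mulr_gt0// exprn_gt0// invr_gt0 sqrtr_gt0.
apply/S5E; under eq_bigr do rewrite sqnorm_scale.
by rewrite -mulr_sumr -/(N q) exprVn sqr_sqrtr ?mulVf ?gt_eqF// ltW.
Qed.

Lemma iter_generator_regular k p : regular (iter k generator p) <-> regular p.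
Proof.
elim: k => [//|k <-]; rewrite iterS.
by split=> rp j; have := rp j; rewrite sqnorm_generator.
Qed.

(** The regular points form an open dense set that the generator preserves; if the
    lift meets every regular point and no other, its image in the quotient is
    the projection of that set. *)
Lemma regular_image {n : nat} {M : set 'rV[R]_(3 + 3)} (A : set 'rV[R]_n)
    (lift : 'rV[R]_n -> M) :
  (forall x, A x -> regular (set_val (lift x))) ->
  (forall p : M, regular (set_val p) -> exists2 x, A x & lift x = p) ->
  (forall V (p : M), open V -> V (set_val p) ->
     exists2 q : M, V (set_val q) & regular (set_val q)) ->
  open [set orbit_proj (lift x) | x in A] /\ dense [set orbit_proj (lift x) | x in A].
Proof.
move=> lift_reg lift_surj M_dense; split.
  apply/open_orbit_space; exists regular; first exact: open_regular.
  apply/seteqP; split=> [p [x Ax /orbit_projP[k kE]]|p rp].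
    by rewrite /preimage /= kE; apply/iter_generator_regular; exact: lift_reg.
  by have [x Ax <-] := lift_surj p rp; exists x.
move=> O [u Ou] /open_orbit_space[V oV VE].
have [p up] := orbit_proj_surj u; subst u.
have Vp : V (set_val p) by have : (@orbit_proj _ M @^-1` O) p by []; rewrite VE.
have [q Vq rq] := M_dense V p oV Vp.
have [x Ax xq] := lift_surj q rq.
exists (orbit_proj q); split; last by exists x => //; rewrite xq.
by have : (set_val @^-1` V) q by []; rewrite -VE.
Qed.

End RegularPart.

(** * Jacobians in polar coordinates *)

Section JacobianPolar.
Context {R : realType}.

(** The real matrix of the diagonal unitary matrix with entries [exp (i a_j)],
    which acts on row vectors. *)
Definition rotation (a : 'rV[R]_3) : 'M[R]_(3 + 3) :=
  block_mx (diag_mx (map_mx cos a)) (diag_mx (map_mx sin a))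
           (- diag_mx (map_mx sin a)) (diag_mx (map_mx cos a)).

(** Multiplication by [i] on [C^3]. *)
Definition mul_i : 'M[R]_(3 + 3) := block_mx 0 1%:M (- 1%:M) 0.

Lemma mul_i_sq : mul_i *m mul_i = - 1%:M.
Proof.
rewrite /mul_i mulmx_block !mul0mx !mulmx0 !mul1mx !mulmx1 !add0r !addr0.
by rewrite [in RHS]scalar_mx_block opp_block_mx oppr0.
Qed.

Lemma mul_i_tr : mul_i *m mul_i^T = 1%:M.
Proof.
rewrite /mul_i tr_block_mx !trmx0 !linearN /= trmx1 mulmx_block.
rewrite !mul0mx !mulmx0 mulNmx mulmxN !mulmx1 opprK !add0r !addr0.
by rewrite -scalar_mx_block.
Qed.

Lemma rotation_mul_i a : rotation a *m mul_i = mul_i *m rotation a.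
Proof.
rewrite /rotation /mul_i !mulmx_block !mul0mx !mulmx0 !mul1mx !mulmx1 !add0r !addr0.
by rewrite !mulmxN !mulNmx !mulmx1 !mul1mx.
Qed.

Lemma rotation_tr a : rotation a *m (rotation a)^T = 1%:M.
Proof.
rewrite /rotation tr_block_mx !linearN /= !tr_diag_mx mulmx_block.
rewrite !mulmxN !mulNmx opprK !mulmx_diag [in RHS]scalar_mx_block.
have cs : diag_mx (\row_i (map_mx cos a 0 i * map_mx cos a 0 i)) +
          diag_mx (\row_i (map_mx sin a 0 i * map_mx sin a 0 i)) = 1%:M :> 'M[R]_3.
  rewrite -raddfD /= -diag_const_mx; congr diag_mx; apply/rowP => j.
  by rewrite !mxE -!expr2 cos2Dsin2.
have sc : diag_mx (\row_i (map_mx sin a 0 i * map_mx cos a 0 i)) =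
          diag_mx (\row_i (map_mx cos a 0 i * map_mx sin a 0 i)).
  by congr diag_mx; apply/rowP => j; rewrite !mxE mulrC.
by congr block_mx; rewrite ?sc ?cs ?addNr ?subrr// addrC cs.
Qed.

(** The derivative of [A_j exp (i a_j)] is [dA_j + i A_j da_j], rotated by
    [exp (i a_j)]. *)
Lemma jac_polar {n : nat} (A a : 'rV[R]_n -> 'rV[R]_3) x :
  differentiable A x -> differentiable a x ->
  differentiable (fun y => polar (A y) (a y)) x /\
  jac (fun y => polar (A y) (a y)) x =
    row_mx (jac A x) (jac a x *m diag_mx (A x)) *m rotation (a x).
Proof.
move=> dA da.
have dA' j : differentiable (fun y => A y 0 j) x by exact: (differentiable_mxP A x).1.
have da' j : differentiable (fun y => a y 0 j) x by exact: (differentiable_mxP a x).1.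
have dc j : is_derive (a x 0 j) 1 cos (- sin (a x 0 j)) by exact: is_derive_cos.
have ds j : is_derive (a x 0 j) 1 sin (cos (a x 0 j)) by exact: is_derive_sin.
have dcc j := differentiable_chain (da' j) (dc j).
have dss j := differentiable_chain (da' j) (ds j).
have pl y j : polar (A y) (a y) 0 (lshift 3 j) = A y 0 j * cos (a y 0 j).
  by rewrite row_mxEl mxE.
have pr y j : polar (A y) (a y) 0 (rshift 3 j) = A y 0 j * sin (a y 0 j).
  by rewrite row_mxEr mxE.
have dP : differentiable (fun y => polar (A y) (a y)) x.
  apply/differentiable_mxP => i k; rewrite ord1; case: (split_ordP k) => j ->.
    by under eq_fun do rewrite pl; exact: differentiableM (dA' j) (dcc j).
  by under eq_fun do rewrite pr; exact: differentiableM (dA' j) (dss j).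
split=> //; apply/matrixP => i k; rewrite jac_pd// /rotation mul_row_block.
have jA j : jac A x i j = pd i (fun y => A y 0 j) x by rewrite jac_pd.
have ja j : jac a x i j = pd i (fun y => a y 0 j) x by rewrite jac_pd.
case: (split_ordP k) => j ->.
  under eq_fun do rewrite pl; rewrite (pdM _ (dA' j) (dcc j)) (pd_chain _ (da' j) (dc j)).
  rewrite row_mxEl mulmxN !mul_mx_diag !mxE jA ja /=; ring.
under eq_fun do rewrite pr; rewrite (pdM _ (dA' j) (dss j)) (pd_chain _ (da' j) (ds j)).
rewrite row_mxEr !mul_mx_diag !mxE jA ja /=; ring.
Qed.

End JacobianPolar.

(** * The coordinate chart of the cone *)

Section ConeCoordinates.
Context {R : realType}.
Implicit Types (y : 'rV[R]_(1 + 5)) (x : 'rV[R]_5).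

Definition cone_X5 : set 'rV[R]_(1 + 5) := cone_domain X5_domain.

Lemma rsubmx_coord y : [/\ rsubmx y 0 0 = y 0 1, rsubmx y 0 1 = y 0 2, rsubmx y 0 2 = y 0 3,
  rsubmx y 0 3 = y 0 4 & rsubmx y 0 4 = y 0 5].
Proof. by split; rewrite mxE; congr (y _ _); apply: val_inj. Qed.

Lemma cone_point_coord (r : R) x : [/\ cone_point r x 0 0 = r, cone_point r x 0 1 = x 0 0
  & [/\ cone_point r x 0 2 = x 0 1, cone_point r x 0 3 = x 0 2,
       cone_point r x 0 4 = x 0 3 & cone_point r x 0 5 = x 0 4]].
Proof.
have [<- <- <- <- <-] := rsubmx_coord (cone_point r x); rewrite /cone_point row_mxKr.
split=> //; have -> : 0 = lshift 5 (0 : 'I_1) :> 'I_(1 + 5) by apply: val_inj.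
by rewrite row_mxEl mxE.
Qed.

Lemma cone_X5E y : cone_X5 y <->
  [/\ 0 < y 0 0, - (3 / 2) < y 0 1 < 0 & 0 < y 0 2 < pi].
Proof.
have [E0 E1 _ _ _] := rsubmx_coord y.
rewrite /cone_X5 /cone_domain /X5_domain /= E0 E1; split=> [[? []]|[]]; by split.
Qed.

Lemma open_coord_itv {n : nat} (j : 'I_n) (a b : R) :
  open [set x : 'rV[R]_n | a < x 0 j < b].
Proof.
have -> : [set x : 'rV[R]_n | a < x 0 j < b] =
          [set x : 'rV[R]_n | a < x 0 j] `&` [set x : 'rV[R]_n | x 0 j < b].
  by apply/seteqP; split=> x /= => [/andP[]//|[-> ->]].
apply: openI.
  by apply: open_comp (@open_gt R a) => x _; exact: coord_continuous.
by apply: open_comp (@open_lt R b) => x _; exact: coord_continuous.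
Qed.

Lemma open_X5_domain : open (@X5_domain R).
Proof. by apply: openI; exact: open_coord_itv. Qed.

Lemma open_cone_X5 : open cone_X5.
Proof.
have o0 : open [set x : 'rV[R]_(1 + 5) | 0 < x 0 0].
  by apply: open_comp (@open_gt R 0) => x _; exact: coord_continuous.
have -> : cone_X5 = [set x | 0 < x 0 0] `&`
   ([set x | - (3 / 2) < x 0 1 < 0] `&` [set x | 0 < x 0 2 < pi]).
  by apply/seteqP; split=> y; rewrite cone_X5E => -[? []].
by apply: openI => //; apply: openI; exact: open_coord_itv.
Qed.

Definition rho y : R := Num.sqrt (- (2 / 3) * y 0 1).
Definition sigma y : R := Num.sqrt (1 + 2 / 3 * y 0 1).
Definition cos_half y : R := cos (y 0 2 / 2).
Definition sin_half y : R := sin (y 0 2 / 2).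

(** On the domain the chart is governed by the two points [(rho, sigma)] and
    [(cos_half, sin_half)] of the unit circle, with [t = - 3/2 rho^2]. *)
Lemma domain_facts y : cone_X5 y ->
  [/\ [/\ 0 < y 0 0, 0 < rho y, 0 < sigma y, 0 < cos_half y & 0 < sin_half y],
      y 0 1 = - (3 / 2) * rho y ^+ 2, sigma y ^+ 2 = 1 - rho y ^+ 2 &
      cos_half y ^+ 2 = 1 - sin_half y ^+ 2].
Proof.
rewrite cone_X5E => -[r0 /andP[t1 t2] /andP[h1 h2]].
have p1 : 0 < - (2 / 3) * y 0 1 by lra.
have p2 : 0 < 1 + 2 / 3 * y 0 1 by lra.
split; last 1 first.
- by rewrite /cos_half /sin_half cos2sin2.
- have pi0 := pi_gt0 R; split; rewrite ?sqrtr_gt0//.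
    apply: cos_gt0_pihalf; apply/andP; split; lra.
  apply: sin_gt0_pihalf; apply/andP; split; lra.
- rewrite /rho sqr_sqrtr; last exact: ltW.
  by field.
- rewrite /rho /sigma !sqr_sqrtr; try exact: ltW.
  by ring.
Qed.

(** The moduli of the three complex coordinates, on the cone. *)
Definition amp y : 'rV[R]_3 := \row_j
  [:: y 0 0 * (rho y * cos_half y); y 0 0 * (rho y * sin_half y); y 0 0 * sigma y]`_j.

(** The arguments are [tau/2 + chi/3], [tau/2 + chi/3 + phi] and [2 chi/3]; row [i]
    holds the coefficients of the [i]-th coordinate. *)
Definition ang_mx : 'M[R]_(1 + 5, 3) := \matrix_(i, j)
  [:: (i == 4)%:R / 2 + (i == 5)%:R / 3;
      (i == 4)%:R / 2 + (i == 5)%:R / 3 + (i == 3)%:R;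
      2 / 3 * (i == 5)%:R]`_j.

Definition ang y : 'rV[R]_3 := y *m ang_mx.

(** The developing map of the cone. With [rho^2 = - 2t/3] and [sigma^2 = 1 - rho^2],
    it sends the point with radius [r] to
    [r (rho cos (theta/2) e^(i (tau/2 + chi/3)),
        rho sin (theta/2) e^(i (tau/2 + chi/3 + phi)), sigma e^(2 i chi/3))]. *)
Definition cone_map y : 'rV[R]_(3 + 3) := polar (amp y) (ang y).

(** The Jacobian of [amp]. The Kronecker deltas encode the rows, so that the metric
    becomes a polynomial identity in them. *)
Definition amp_mx y : 'M[R]_(1 + 5, 3) := \matrix_(i, j)
  [:: (i == 0)%:R * (rho y * cos_half y) + y 0 0 *
        (- (3 * rho y)^-1 * (i == 1)%:R * cos_half y - rho y * (sin_half y / 2 * (i == 2)%:R));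
      (i == 0)%:R * (rho y * sin_half y) + y 0 0 *
        (- (3 * rho y)^-1 * (i == 1)%:R * sin_half y + rho y * (cos_half y / 2 * (i == 2)%:R));
      (i == 0)%:R * sigma y + y 0 0 * ((3 * sigma y)^-1 * (i == 1)%:R)]`_j.

Lemma rho_smooth : smooth_on cone_X5 rho.
Proof.
apply: (smooth_sqrt open_cone_X5).
  by move=> y /cone_X5E[_ /andP[_ t2] _]; lra.
apply: (smoothM open_cone_X5); first exact: smooth_cst.
exact: smooth_coord.
Qed.

Lemma sigma_smooth : smooth_on cone_X5 sigma.
Proof.
apply: (smooth_sqrt open_cone_X5).
  by move=> y /cone_X5E[_ /andP[t1 t2] _]; lra.
apply: (smoothD open_cone_X5); first exact: smooth_cst.
apply: (smoothM open_cone_X5); first exact: smooth_cst.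
exact: smooth_coord.
Qed.

Let half_smooth : smooth_on cone_X5 (fun y => y 0 2 / 2).
Proof.
apply: (smoothM open_cone_X5); last exact: smooth_cst.
exact: smooth_coord.
Qed.

Lemma cos_half_smooth : smooth_on cone_X5 cos_half.
Proof. exact: (smooth_sin_cos open_cone_X5 half_smooth).2. Qed.

Lemma sin_half_smooth : smooth_on cone_X5 sin_half.
Proof. exact: (smooth_sin_cos open_cone_X5 half_smooth).1. Qed.

Lemma amp_smooth : smooth_on cone_X5 amp.
Proof.
apply: (smooth_mx open_cone_X5) => i j; under eq_fun do rewrite mxE.
have [->|[->| ->]] := ord3P j; (apply: (smoothM open_cone_X5); first exact: smooth_coord) => /=.
- by apply: (smoothM open_cone_X5); [exact: rho_smooth|exact: cos_half_smooth].
- by apply: (smoothM open_cone_X5); [exact: rho_smooth|exact: sin_half_smooth].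
- exact: sigma_smooth.
Qed.

Lemma ang_smooth : smooth_on cone_X5 ang.
Proof.
apply: (smooth_mulmx open_cone_X5).
  apply: (smooth_mx open_cone_X5) => i j; rewrite (ord1 i); exact: smooth_coord.
apply: (smooth_mx open_cone_X5) => i j; exact: smooth_cst.
Qed.

Lemma cone_map_smooth : smooth_on cone_X5 cone_map.
Proof.
apply: (smooth_mx open_cone_X5) => i k; rewrite (ord1 i).
have sa j := smooth_sin_cos open_cone_X5 (smooth_entry open_cone_X5 0 j ang_smooth).
case: (split_ordP k) => j ->.
  under eq_fun do rewrite row_mxEl mxE.
  apply: (smoothM open_cone_X5); last exact: (sa j).2.
  exact: (smooth_entry open_cone_X5 0 j amp_smooth).
under eq_fun do rewrite row_mxEr mxE.
apply: (smoothM open_cone_X5); last exact: (sa j).1.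
exact: (smooth_entry open_cone_X5 0 j amp_smooth).
Qed.

Lemma jac_ang y : jac ang y = ang_mx.
Proof.
have df (k : 'I_(1 + 5)) j :
    differentiable (fun z : 'rV[R]_(1 + 5) => z 0 k * ang_mx k j) y.
  by apply: differentiableM; [exact: differentiable_coord|exact: differentiable_cst].
have angE j z : ang z 0 j = \sum_k z 0 k * ang_mx k j by rewrite mxE.
have dang : differentiable ang y.
  apply/differentiable_mxP => i j; rewrite (ord1 i); under eq_fun do rewrite angE.
  exact: (pd_sum (index_enum _) 0 (fun k => df k j)).1.
apply/matrixP => i j; rewrite jac_pd//; under eq_fun do rewrite angE.
rewrite (pd_sum (index_enum _) i (fun k => df k j)).2.
rewrite (bigD1 i)//= big1 => [|k ki].
  rewrite pdM ?pd_coord ?pd_cst ?eqxx ?mul1r ?mulr0 ?addr0//;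
    (exact: differentiable_coord || exact: differentiable_cst).
rewrite pdM ?pd_coord ?pd_cst 1?eq_sym ?(negPf ki) ?mul0r ?mulr0 ?addr0//;
  (exact: differentiable_coord || exact: differentiable_cst).
Qed.

End ConeCoordinates.

(** * The induced metric *)

Section ConeGram.
Context {R : realType}.
Implicit Types (y : 'rV[R]_(1 + 5)) (x : 'rV[R]_5).

Lemma pd_rho i y : cone_X5 y ->
  differentiable rho y /\ pd i rho y = - (3 * rho y)^-1 * (i == 1)%:R.
Proof.
move=> Cy; have [[_ r0 _ _ _] _ _ _] := domain_facts Cy.
split; first exact: smooth_differentiable rho_smooth Cy.
have p1 : 0 < - (2 / 3) * y 0 1 by move/cone_X5E: Cy => [_ /andP[_ ?] _]; lra.
have dc : differentiable (fun z : 'rV[R]_(1 + 5) => z 0 1) y by exact: differentiable_coord.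
have dm : differentiable (fun z : 'rV[R]_(1 + 5) => - (2 / 3) * z 0 1) y.
  by apply: differentiableM => //; exact: differentiable_cst.
have := pd_chain i dm (is_derive1_sqrt p1); rewrite /comp -/rho => ->.
rewrite (pdM _ _ dc); last exact: differentiable_cst.
rewrite pd_cst pd_coord -/(rho y); move: r0; rewrite lt0r => /andP[r0 _].
by field.
Qed.

Lemma pd_sigma i y : cone_X5 y ->
  differentiable sigma y /\ pd i sigma y = (3 * sigma y)^-1 * (i == 1)%:R.
Proof.
move=> Cy; have [[_ _ r0 _ _] _ _ _] := domain_facts Cy.
split; first exact: smooth_differentiable sigma_smooth Cy.
have p1 : 0 < 1 + 2 / 3 * y 0 1 by move/cone_X5E: Cy => [_ /andP[? _] _]; lra.
have dc : differentiable (fun z : 'rV[R]_(1 + 5) => z 0 1) y by exact: differentiable_coord.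
have dm1 : differentiable (fun z : 'rV[R]_(1 + 5) => 2 / 3 * z 0 1) y.
  by apply: differentiableM => //; exact: differentiable_cst.
have dm : differentiable (fun z : 'rV[R]_(1 + 5) => 1 + 2 / 3 * z 0 1) y.
  by apply: differentiableD => //; exact: differentiable_cst.
have := pd_chain i dm (is_derive1_sqrt p1); rewrite /comp -/sigma => ->.
rewrite (pdD _ _ dm1); last exact: differentiable_cst.
rewrite (pdM _ _ dc); last exact: differentiable_cst.
rewrite !pd_cst pd_coord -/(sigma y); move: r0; rewrite lt0r => /andP[r0 _].
by field.
Qed.

Lemma pd_half i y :
  differentiable (fun z : 'rV[R]_(1 + 5) => z 0 2 / 2) y /\
  pd i (fun z : 'rV[R]_(1 + 5) => z 0 2 / 2) y = (i == 2)%:R / 2.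
Proof.
have dc : differentiable (fun z : 'rV[R]_(1 + 5) => z 0 2) y by exact: differentiable_coord.
split; first by apply: differentiableM => //; exact: differentiable_cst.
rewrite (pdM _ dc); last exact: differentiable_cst.
by rewrite pd_cst pd_coord mulr0 addr0.
Qed.

Lemma pd_cos_half i y : differentiable cos_half y /\ pd i cos_half y = - (sin_half y / 2 * (i == 2)%:R).
Proof.
have [dh ph] := pd_half i y; have dc := is_derive_cos (y 0 2 / 2).
split; first exact: (differentiable_chain dh dc).
have := pd_chain i dh dc; rewrite /comp -/cos_half => ->.
by rewrite ph /sin_half; ring.
Qed.

Lemma pd_sin_half i y : differentiable sin_half y /\ pd i sin_half y = cos_half y / 2 * (i == 2)%:R.
Proof.
have [dh ph] := pd_half i y; have dc := is_derive_sin (y 0 2 / 2).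
split; first exact: (differentiable_chain dh dc).
have := pd_chain i dh dc; rewrite /comp -/sin_half => ->.
by rewrite ph /cos_half; ring.
Qed.

Lemma jac_amp y : cone_X5 y -> jac amp y = amp_mx y.
Proof.
move=> Cy; apply/matrixP => i j.
rewrite jac_pd; last exact: smooth_differentiable amp_smooth Cy.
have [dr pr] := pd_rho i Cy; have [ds ps] := pd_sigma i Cy.
have [dc pc] := pd_cos_half i y; have [dsn psn] := pd_sin_half i y.
have d0 : differentiable (fun z : 'rV[R]_(1 + 5) => z 0 0) y by exact: differentiable_coord.
under eq_fun do rewrite mxE; rewrite mxE.
have [->|[->| ->]] := ord3P j => /=.
- rewrite (pdM _ d0 (differentiableM dr dc)) (pdM _ dr dc) pd_coord pr pc.
  by rewrite -[(rho * cos_half) y]/(rho y * cos_half y); ring.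
- rewrite (pdM _ d0 (differentiableM dr dsn)) (pdM _ dr dsn) pd_coord pr psn.
  by rewrite -[(rho * sin_half) y]/(rho y * sin_half y); ring.
- by rewrite (pdM _ d0 ds) pd_coord ps.
Qed.

(** The Jacobian of [cone_map] before the rotation by the arguments; its entries
    depend on [r], [t] and [theta] only. *)
Definition frame y : 'M[R]_(1 + 5, 3 + 3) := row_mx (amp_mx y) (ang_mx *m diag_mx (amp y)).

Lemma jac_cone_map y : cone_X5 y -> jac cone_map y = frame y *m rotation (ang y).
Proof.
move=> Cy; rewrite (jac_polar _ _).2 ?jac_ang ?jac_amp//.
  exact: smooth_differentiable amp_smooth Cy.
exact: smooth_differentiable ang_smooth Cy.
Qed.

Lemma X5_metricE x i j : let t := x 0 0 in
  let d (k : 'I_5) (i : 'I_5) : R := (i == k)%:R in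
  let eta i := d 3 i + (1 - cos (x 0 1)) * d 2 i in
  X5_metric x i j =
  - (t / 6) * (d 1 i * d 1 j + sin (x 0 1) ^+ 2 * (d 2 i * d 2 j))
  - (2 * t * (2 * t + 3))^-1 * (d 0 i * d 0 j)
  - 2 * t * (2 * t + 3) / 9 * ((3^-1 * d 4 i - 2^-1 * eta i) * (3^-1 * d 4 j - 2^-1 * eta j))
  + 4 / 9 * (((t / 3 + 1) * d 4 i - t / 2 * eta i) * ((t / 3 + 1) * d 4 j - t / 2 * eta j)).
Proof.
rewrite /= /X5_metric; repeat (rewrite mxE || rewrite big_ord1).
by [].
Qed.

Lemma rshift1_eq (v : 'I_5) :
  [/\ (rshift 1 v == 0 :> 'I_(1 + 5)) = false, (rshift 1 v == 1 :> 'I_(1 + 5)) = (v == 0),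
      (rshift 1 v == 2 :> 'I_(1 + 5)) = (v == 1), (rshift 1 v == 3 :> 'I_(1 + 5)) = (v == 2)
    & (rshift 1 v == 4 :> 'I_(1 + 5)) = (v == 3) /\
      (rshift 1 v == 5 :> 'I_(1 + 5)) = (v == 4)].
Proof. by move: v; do 5?[case=> [[|[|[|[|[|//]]]]] ?]]. Qed.

Lemma cone_metricE y i j : let t := y 0 1 in
  let d (k : 'I_(1 + 5)) (i : 'I_(1 + 5)) : R := (i == k)%:R in
  let eta i := d 4 i + (1 - cos (y 0 2)) * d 3 i in
  cone_metric X5_metric y i j = d 0 i * d 0 j + y 0 0 ^+ 2 *
  (- (t / 6) * (d 2 i * d 2 j + sin (y 0 2) ^+ 2 * (d 3 i * d 3 j))
  - (2 * t * (2 * t + 3))^-1 * (d 1 i * d 1 j)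
  - 2 * t * (2 * t + 3) / 9 * ((3^-1 * d 5 i - 2^-1 * eta i) * (3^-1 * d 5 j - 2^-1 * eta j))
  + 4 / 9 * (((t / 3 + 1) * d 5 i - t / 2 * eta i) * ((t / 3 + 1) * d 5 j - t / 2 * eta j))).
Proof.
move=> t d eta.
have dl k (u : 'I_1) : d k (lshift 5 u) = (k == 0)%:R.
  by rewrite (ord1 u) /d eq_sym; congr (_ == _)%:R; apply: val_inj.
have [t0 t1 _ _ _] := rsubmx_coord y.
rewrite /cone_metric; case: (split_ordP i) => u ->; case: (split_ordP j) => v ->.
- rewrite block_mxEul mxE (ord1 u) (ord1 v) /eta !dl /=; ring.
- have [v0 _ _ _ _] := rshift1_eq v.
  by rewrite block_mxEur mxE (ord1 u) /eta !dl /d v0 /=; ring.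
- have [u0 _ _ _ _] := rshift1_eq u.
  by rewrite block_mxEdl mxE (ord1 v) /eta !dl /d u0 /=; ring.
- rewrite block_mxEdr mxE X5_metricE t0 t1 -/t /eta /d.
  have [-> -> -> -> [-> ->]] := rshift1_eq u; have [-> -> -> -> [-> ->]] := rshift1_eq v.
  by rewrite mul0r add0r.
Qed.

(** The variables [R], [T], [H], [P], [U], [X] stand for the values of [dr], [dt],
    [dtheta], [dphi], [dtau], [dchi] on two vectors. The left-hand side is the
    flat metric [\sum_j dA_j^2 + A_j^2 da_j^2] in polar coordinates, the right-hand
    side the cone over [ds^2_X5]. *)
Lemma gram_identity (r p q c s R1 T1 H1 P1 U1 X1 R2 T2 H2 P2 U2 X2 : R) :
  p != 0 -> q != 0 -> q ^+ 2 = 1 - p ^+ 2 -> c ^+ 2 = 1 - s ^+ 2 ->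
  let t := - (3 / 2) * p ^+ 2 in let cos_theta := 1 - 2 * s ^+ 2 in
  (R1 * (p * c) + r * (- (3 * p)^-1 * T1 * c - p * (s / 2 * H1))) *
    (R2 * (p * c) + r * (- (3 * p)^-1 * T2 * c - p * (s / 2 * H2)))
  + (R1 * (p * s) + r * (- (3 * p)^-1 * T1 * s + p * (c / 2 * H1))) *
    (R2 * (p * s) + r * (- (3 * p)^-1 * T2 * s + p * (c / 2 * H2)))
  + (R1 * q + r * ((3 * q)^-1 * T1)) * (R2 * q + r * ((3 * q)^-1 * T2))
  + ((U1 / 2 + X1 / 3) * (U2 / 2 + X2 / 3) * (r * (p * c)) ^+ 2
     + (U1 / 2 + X1 / 3 + P1) * (U2 / 2 + X2 / 3 + P2) * (r * (p * s)) ^+ 2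
     + 2 / 3 * X1 * (2 / 3 * X2) * (r * q) ^+ 2)
  = R1 * R2 + r ^+ 2 *
    (- (t / 6) * (H1 * H2 + (2 * (c * s)) ^+ 2 * (P1 * P2))
     - (2 * t * (2 * t + 3))^-1 * (T1 * T2)
     - 2 * t * (2 * t + 3) / 9 * ((3^-1 * X1 - 2^-1 * (U1 + (1 - cos_theta) * P1)) *
                                  (3^-1 * X2 - 2^-1 * (U2 + (1 - cos_theta) * P2)))
     + 4 / 9 * (((t / 3 + 1) * X1 - t / 2 * (U1 + (1 - cos_theta) * P1)) *
                ((t / 3 + 1) * X2 - t / 2 * (U2 + (1 - cos_theta) * P2)))).
Proof.
move=> p0 q0 Hq Hc t cos_theta.
have -> : 2 * t * (2 * t + 3) = - 9 * p ^+ 2 * q ^+ 2 by rewrite /t Hq; field.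
rewrite /t /cos_theta; field: Hq Hc.
by rewrite p0 q0.
Qed.

Lemma frame_gram y : cone_X5 y -> frame y *m (frame y)^T = cone_metric X5_metric y.
Proof.
move=> Cy; have [[r0 p0 q0 c0 s0] tE sg ch] := domain_facts Cy.
apply/matrixP => i k; rewrite cone_metricE.
rewrite /frame tr_row_mx mul_row_col trmx_mul tr_diag_mx mulmxA mxE.
have sum3 (f : 'I_3 -> R) : \sum_j f j = f 0 + f 1 + f 2.
  rewrite !big_ord_recl big_ord0 addr0 addrA.
  by congr (f _ + f _ + f _); apply: val_inj.
have -> : (amp_mx y *m (amp_mx y)^T) i k =
   amp_mx y i 0 * amp_mx y k 0 + amp_mx y i 1 * amp_mx y k 1 + amp_mx y i 2 * amp_mx y k 2.
  by rewrite mxE sum3 !(mxE trmx_key).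
have -> : (ang_mx *m diag_mx (amp y) *m diag_mx (amp y) *m ang_mx^T) i k =
   ang_mx i 0 * ang_mx k 0 * amp y 0 0 ^+ 2 + ang_mx i 1 * ang_mx k 1 * amp y 0 1 ^+ 2
   + ang_mx i 2 * ang_mx k 2 * amp y 0 2 ^+ 2 :> R.
  by rewrite !mul_mx_diag mxE sum3 !mxE; ring.
have half2 (x : R) : x = (x / 2) *+ 2 by rewrite -mulr_natr divfK.
have -> : cos (y 0 2) = 1 - 2 * sin_half y ^+ 2.
  rewrite [y 0 2]half2.
  by rewrite cos_mulr2n cos2sin2 /sin_half; ring.
have -> : sin (y 0 2) = 2 * (cos_half y * sin_half y).
  rewrite [y 0 2]half2.
  by rewrite sin_mulr2n /sin_half /cos_half -mulr_natl.
rewrite !mxE /= tE.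
apply: gram_identity => //; exact: lt0r_neq0.
Qed.


End ConeGram.

(** * The Kaehler structure of the cone *)

Lemma unitmx_of_kernel {F : fieldType} {n : nat} (M : 'M[F]_n) :
  (forall v : 'rV_n, v *m M = 0 -> v = 0) -> M \in unitmx.
Proof.
move=> kM; rewrite -row_free_unit -kermx_eq0; apply/eqP/row_matrixP => i.
rewrite row0; apply: kM; by rewrite -row_mul mulmx_ker row0.
Qed.

Lemma norm0_eq0 {R : realDomainType} {n : nat} (w : 'rV[R]_n) : w *m w^T = 0 -> w = 0.
Proof.
move=> /matrixP/(_ 0 0); rewrite [RHS]mxE mxE => /eqP.
have wE j : w 0 j * w^T j 0 = w 0 j ^+ 2 by rewrite mxE expr2.
rewrite (eq_bigr _ (fun j _ => wE j)) psumr_eq0 => [/allP w0|j _]; last exact: sqr_ge0.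
apply/rowP => j; have := w0 j (mem_index_enum j).
by rewrite /= sqrf_eq0 => /eqP ->; rewrite mxE.
Qed.

(** Over the reals [v M M^T = 0] gives [|v M|^2 = 0]. *)
Lemma gram_unit {R : realType} {n m : nat} (M : 'M[R]_(n, m)) :
  (forall v : 'rV_n, v *m M = 0 -> v = 0) -> M *m M^T \in unitmx.
Proof.
move=> kM; apply: unitmx_of_kernel => v v0; apply: kM.
apply: norm0_eq0; by rewrite trmx_mul mulmxA -(mulmxA v) v0 mul0mx.
Qed.

Section ConeStructure.
Context {R : realType}.
Implicit Types (y : 'rV[R]_(1 + 5)) (x : 'rV[R]_5).

Lemma period_latticeP (w : 'rV[R]_5) : period_lattice w <->
  [/\ w 0 0 = 0, w 0 1 = 0 & exists k l m : int,
    [/\ w 0 2 = 2 * pi * k%:~R, w 0 3 = 2 * pi * l%:~R & w 0 4 = 3 / 2 * pi * m%:~R]].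
Proof.
split=> [[k [l [m ->]]]|[w0 w1 [k [l [m [w2 w3 w4]]]]]].
  split; [| |exists k, l, m; split]; rewrite !mxE /=;
  by rewrite ?mulr0 ?mulr1 ?addr0 ?add0r.
exists k, l, m; apply/rowP => -[[|[|[|[|[|//]]]]] lt_i]; rewrite !mxE /= ?mulr0 ?mulr1 ?addr0 ?add0r;
  [rewrite -[RHS]w0|rewrite -[RHS]w1|rewrite -[RHS]w2|rewrite -[RHS]w3|rewrite -[RHS]w4];
  by congr (w _ _); apply: val_inj.
Qed.

Lemma cone_latticeP (v : 'rV[R]_(1 + 5)) : cone_lattice period_lattice v <->
  [/\ v 0 0 = 0, v 0 1 = 0, v 0 2 = 0 & exists k l m : int,
    [/\ v 0 3 = 2 * pi * k%:~R, v 0 4 = 2 * pi * l%:~R & v 0 5 = 3 / 2 * pi * m%:~R]].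
Proof.
split=> [[w /period_latticeP[w0 w1 Hw] <-]|[v0 v1 v2 Hv]].
  by have [-> -> [-> -> -> ->]] := cone_point_coord 0 w.
have [E0 E1 E2 E3 E4] := rsubmx_coord v.
exists (rsubmx v); first by apply/period_latticeP; rewrite E0 E1 E2 E3 E4.
rewrite -[RHS]hsubmxK /cone_point; congr row_mx; apply/rowP => i.
rewrite (ord1 i) !mxE -[LHS]v0; congr (v _ _); exact: val_inj.
Qed.

Lemma sum6 (f : 'I_(1 + 5) -> R) : \sum_i f i = f 0 + f 1 + f 2 + f 3 + f 4 + f 5.
Proof.
rewrite !big_ord_recl big_ord0 addr0 !addrA.
by congr (f _ + f _ + f _ + f _ + f _ + f _); apply: val_inj.
Qed.

(** The first three rows of [frame] are orthogonal radial vectors, the last three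
    a triangular system in the arguments. *)
Lemma frame_injective y (v : 'rV[R]_(1 + 5)) : cone_X5 y -> v *m frame y = 0 -> v = 0.
Proof.
move=> Cy; have [[r0 p0 q0 c0 s0] _ Hq Hc] := domain_facts Cy.
rewrite /frame mul_mx_row -[RHS]row_mx0 => /eq_row_mx[vA].
rewrite mulmxA mul_mx_diag => vB.
have colA j : \sum_i v 0 i * amp_mx y i j = 0.
  by have /rowP/(_ j) := vA; rewrite mxE [RHS]mxE.
have colB j : \sum_i v 0 i * ang_mx i j = 0.
  have /rowP/(_ j) := vB; rewrite mxE [X in X * _]mxE [RHS]mxE => /eqP.
  rewrite mulf_eq0 => /orP[/eqP//|]; rewrite mxE.
  by have [->|[->| ->]] := ord3P j; rewrite /= !mulf_eq0 ?(gt_eqF r0) ?(gt_eqF p0)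
     ?(gt_eqF q0) ?(gt_eqF c0) ?(gt_eqF s0).
move: (colA 0) (colA 1) (colA 2) (colB 0) (colB 1) (colB 2).
rewrite !sum6 !mxE /= => A0 A1 A2 B0 B1 B2.
move: (y 0 0) (rho y) (sigma y) (cos_half y) (sin_half y) r0 p0 q0 c0 s0 Hq Hc A0 A1 A2.
move=> r p q c s r0 p0 q0 c0 s0 Hq Hc A0 A1 A2.
have np : p != 0 by rewrite gt_eqF.
have nq : q != 0 by rewrite gt_eqF.
have nr : r != 0 by rewrite gt_eqF.
have E0 : v 0 0 * (p * c) + r * (- (3 * p)^-1 * v 0 1 * c - p * (s / 2 * v 0 2)) = 0.
  by rewrite -[RHS]A0; ring.
have E1 : v 0 0 * (p * s) + r * (- (3 * p)^-1 * v 0 1 * s + p * (c / 2 * v 0 2)) = 0.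
  by rewrite -[RHS]A1; ring.
have E2 : v 0 0 * q + r * ((3 * q)^-1 * v 0 1) = 0 by rewrite -[RHS]A2; ring.
have v2 : v 0 2 = 0.
  apply: (mulfI (mulf_neq0 nr np)); rewrite mulr0.
  apply: (@etrans _ _ (2 * (c * (v 0 0 * (p * s) + r * (- (3 * p)^-1 * v 0 1 * s + p * (c / 2 * v 0 2)))
    - s * (v 0 0 * (p * c) + r * (- (3 * p)^-1 * v 0 1 * c - p * (s / 2 * v 0 2)))))).
    by field: Hc.
  by rewrite E0 E1 !mulr0 subrr mulr0.
have v0 : v 0 0 = 0.
  apply: (@etrans _ _ (p * (c * (v 0 0 * (p * c) + r * (- (3 * p)^-1 * v 0 1 * c - p * (s / 2 * v 0 2)))
      + s * (v 0 0 * (p * s) + r * (- (3 * p)^-1 * v 0 1 * s + p * (c / 2 * v 0 2))))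
    + q * (v 0 0 * q + r * ((3 * q)^-1 * v 0 1)))).
    by field: Hq Hc; rewrite np nq.
  by rewrite E0 E1 E2 !mulr0 !addr0 mulr0.
have v1 : v 0 1 = 0.
  move: E2; rewrite v0 mul0r add0r => /eqP; rewrite !mulf_eq0 invr_eq0 mulf_eq0.
  by rewrite (negPf nr) (negPf nq) pnatr_eq0 /= => /eqP.
have v5 : v 0 5 = 0 by lra.
have v4 : v 0 4 = 0 by lra.
have v3 : v 0 3 = 0 by lra.
apply/rowP => -[[|[|[|[|[|[|//]]]]]] lt_i]; rewrite mxE;
  [rewrite -[RHS]v0|rewrite -[RHS]v1|rewrite -[RHS]v2|rewrite -[RHS]v3|rewrite -[RHS]v4|rewrite -[RHS]v5];
  by congr (v _ _); apply: val_inj.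
Qed.

Lemma cone_metric_unit y : cone_X5 y -> cone_metric X5_metric y \in unitmx.
Proof.
move=> Cy; rewrite -frame_gram//; apply: gram_unit => v.
exact: frame_injective.
Qed.

Lemma jac_gram y : cone_X5 y ->
  jac cone_map y *m (jac cone_map y)^T = cone_metric X5_metric y.
Proof.
move=> Cy; rewrite jac_cone_map// trmx_mul mulmxA -(mulmxA (frame y)) rotation_tr mulmx1.
exact: frame_gram.
Qed.

Lemma frame_unit y : cone_X5 y -> (frame y : 'M[R]_(1 + 5)) \in unitmx.
Proof. by move=> Cy; apply: unitmx_of_kernel => v; exact: frame_injective. Qed.

Lemma frame_smooth : smooth_on cone_X5 (@frame R).
Proof.
apply: (smooth_mx open_cone_X5) => i k; case: (split_ordP k) => j ->.
  under eq_fun do rewrite row_mxEl.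
  apply: (smooth_entry open_cone_X5); apply: (smooth_eq open_cone_X5 jac_amp).
  by apply: (smooth_jac open_cone_X5); exact: amp_smooth.
under eq_fun do rewrite row_mxEr mul_mx_diag mxE.
apply: (smoothM open_cone_X5); first exact: smooth_cst.
exact: (smooth_entry open_cone_X5 0 j amp_smooth).
Qed.

(** Multiplication by [i], in the coordinates of the cone. Rotations commute
    with it, so that [frame] may replace the whole Jacobian; this makes it
    independent of [phi], [tau] and [chi]. *)
Definition complex_structure y : 'M[R]_(1 + 5) :=
  (frame y : 'M[R]_(1 + 5)) *m (mul_i : 'M[R]_(1 + 5)) *m invmx (frame y : 'M[R]_(1 + 5)).

Lemma X5_sasakian : sasakian (@X5_domain R) period_lattice X5_metric.
Proof.
apply: (@kaehler_of_flat _ _ cone_X5 (cone_lattice period_lattice)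
  (cone_map : 'rV[R]_(1 + 5) -> 'rV[R]_(1 + 5)) _ open_cone_X5 cone_map_smooth
  (fun y Cy => esym (jac_gram Cy)) cone_metric_unit complex_structure
  (mul_i : 'M[R]_(1 + 5)) mul_i_sq mul_i_tr).
- have sF : smooth_on cone_X5 (@frame R : 'rV[R]_(1 + 5) -> 'M[R]_(1 + 5)) by exact: frame_smooth.
  apply: (smooth_mulmx open_cone_X5); last exact: (smooth_invmx open_cone_X5 frame_unit).
  apply: (smooth_mulmx open_cone_X5) => //.
  by apply: (smooth_mx open_cone_X5) => i j; exact: smooth_cst.
- move=> y v Cy /cone_latticeP[v0 v1 v2 _].
  have E k : v 0 k = 0 -> (y + v) 0 k = y 0 k by move=> vk; rewrite mxE vk addr0.
  suff frameD : frame (y + v) = frame y by rewrite /complex_structure frameD.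
  by rewrite /frame /amp_mx /amp /rho /sigma /cos_half /sin_half !E.
- move=> y Cy; rewrite jac_cone_map// /complex_structure.
  have uF := frame_unit Cy.
  rewrite -mulmxA [invmx _ *m _](_ : _ = rotation (ang y) :> 'M[R]_(1 + 5)).
    by rewrite -!mulmxA; congr (_ *m _); rewrite [RHS]rotation_mul_i.
  exact: (mulKmx uF).
Qed.

End ConeStructure.

(** * The unit sphere as a slice of the cone *)

Section Slice.
Context {R : realType} {n : nat}.
Implicit Types (x : 'rV[R]_n) (A : set 'rV[R]_(1 + n)).

Lemma cone_pointD (r h : R) x (i : 'I_n) :
  cone_point r (h *: delta_mx 0 i + x) = h *: delta_mx 0 (rshift 1 i) + cone_point r x.
Proof.
have L z (j : 'I_1) : cone_point r z 0 (lshift n j) = r%:M 0 j by rewrite row_mxEl.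
have P z (j : 'I_n) : cone_point r z 0 (rshift 1 j) = z 0 j by rewrite row_mxEr.
have D m (u v : 'rV[R]_m) k : (h *: u + v) 0 k = h * u 0 k + v 0 k by rewrite !mxE.
apply/rowP => k; rewrite D; case: (split_ordP k) => j ->; rewrite ?L ?P ?D !(mxE delta_mx_key).
  by rewrite eq_lrshift mulr0 add0r.
by rewrite eqxx eq_rshift.
Qed.

(** The map [cone_point r] is affine, and its linear part is the inclusion of the
    last [n] coordinates, so the difference quotients of both sides coincide. *)
Lemma pd_slice {W : normedModType R} (f : 'rV[R]_(1 + n) -> W) (r : R) i x :
  pd i (f \o cone_point r) x = pd (rshift 1 i) f (cone_point r x).
Proof.
rewrite !pdE /derive; set d := (fun _ : R => _); set d' := (fun _ : R => _).
suff -> : d = d' by [].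
by apply/funext => h; rewrite /d /d' /= cone_pointD.
Qed.

Lemma differentiable_slice (r : R) x : differentiable (cone_point r) x.
Proof.
apply/differentiable_mxP => i k; rewrite (ord1 i); case: (split_ordP k) => j ->.
  by under eq_fun do rewrite row_mxEl; exact: differentiable_cst.
by under eq_fun do rewrite row_mxEr; exact: differentiable_coord.
Qed.

Lemma smooth_slice {W : normedModType R} A (f : 'rV[R]_(1 + n) -> W) (r : R) :
  smooth_on A f -> smooth_on [set x | A (cone_point r x)] (f \o cone_point r).
Proof.
move=> /smooth_onP Cf; apply/smooth_onP => k; move: (Cf k).
elim: k f {Cf} => [|k IH] f [df Cf]; (split; [move=> x Ax|]); [|by []| |move=> i].
- by apply: differentiable_comp; [exact: differentiable_slice|exact: df].
- by apply: differentiable_comp; [exact: differentiable_slice|exact: df].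
- have -> : pd i (f \o cone_point r) = pd (rshift 1 i) f \o cone_point r.
    by apply/funext => x; exact: pd_slice.
  by apply: IH; exact: Cf.
Qed.

End Slice.

Section Link.
Context {R : realType}.
Implicit Types (y : 'rV[R]_(1 + 5)) (x : 'rV[R]_5).

Definition link_map x : 'rV[R]_(3 + 3) := cone_map (cone_point 1 x).

Lemma cone_X5_point (r : R) x : 0 < r -> X5_domain x -> cone_X5 (cone_point r x).
Proof.
by move=> r0 Dx; split; [have [-> _ _] := cone_point_coord r x|rewrite row_mxKr].
Qed.

Lemma link_map_smooth : smooth_on X5_domain link_map.
Proof.
have /smooth_onP S := smooth_slice (r := 1) (@cone_map_smooth R).
apply/smooth_onP => k; move: (S k).
have -> : [set x : 'rV[R]_5 | cone_X5 (cone_point 1 x)] = X5_domain.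
  apply/seteqP; split=> x /= => [[_]|]; first by rewrite row_mxKr.
  exact: cone_X5_point ltr01.
by [].
Qed.

Lemma link_gram x : X5_domain x ->
  X5_metric x = jac link_map x *m (jac link_map x)^T.
Proof.
move=> Dx; have Cx := cone_X5_point ltr01 Dx.
have jE i a : jac link_map x i a = jac cone_map (cone_point 1 x) (rshift 1 i) a.
  rewrite jac_pd; last exact: smooth_differentiable link_map_smooth Dx.
  rewrite jac_pd; last exact: smooth_differentiable (@cone_map_smooth R) Cx.
  exact: (pd_slice (fun y => cone_map y 0 a) 1 i x).
apply/matrixP => i j; rewrite [RHS]mxE.
under eq_bigr do rewrite mxE !jE.
have /matrixP/(_ (rshift 1 i) (rshift 1 j)) := jac_gram Cx.
rewrite /cone_metric block_mxEdr row_mxKr mxE.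
have [-> _ _] := cone_point_coord 1 x; rewrite expr1n scale1r => <-.
by apply: eq_bigr => a _; rewrite mxE.
Qed.

Lemma X5_metric_unit x : X5_domain x -> X5_metric x \in unitmx.
Proof.
move=> Dx; have := cone_metric_unit (cone_X5_point ltr01 Dx).
rewrite /cone_metric row_mxKr; have [-> _ _] := cone_point_coord 1 x.
by rewrite expr1n scale1r !unitmxE det_ublock det1 mul1r.
Qed.

Lemma sum_sqnorm_cone_map y : cone_X5 y -> \sum_j sqnorm (cone_map y) j = y 0 0 ^+ 2.
Proof.
move=> Cy; have [_ _ Hq Hc] := domain_facts Cy.
under eq_bigr do rewrite sqnorm_polar.
have -> : \sum_j amp y 0 j ^+ 2 = amp y 0 0 ^+ 2 + amp y 0 1 ^+ 2 + amp y 0 2 ^+ 2.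
  rewrite !big_ord_recl big_ord0 addr0 addrA.
  by congr (amp y 0 _ ^+ 2 + amp y 0 _ ^+ 2 + amp y 0 _ ^+ 2); apply: val_inj.
by rewrite !mxE /=; ring: Hq Hc.
Qed.

Lemma mulmx_sqnorm (p : 'rV[R]_(3 + 3)) : p *m p^T = (\sum_j sqnorm p j)%:M.
Proof.
have T k : p^T k 0 = p 0 k by rewrite mxE.
apply/matrixP => i j; rewrite !ord1 [LHS]mxE [RHS]mxE mulr1n big_split_ord /= -big_split.
by apply: eq_bigr => k _; rewrite /= !T /sqnorm !expr2.
Qed.

(** [link_map] immerses the five-dimensional chart in the unit sphere of [R^6]. *)
Lemma X5_einstein : einstein (@X5_domain R) X5_metric 4.
Proof.
have -> : 4 = 5%:R - 1 :> R by ring.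
apply: (@einstein_of_sphere _ _ X5_domain (link_map : 'rV[R]_5 -> 'rV[R]_(1 + 5)) _
  open_X5_domain link_map_smooth link_gram X5_metric_unit).
move=> x Dx; have := mulmx_sqnorm (link_map x).
rewrite sum_sqnorm_cone_map; last exact: cone_X5_point ltr01 Dx.
have [-> _ _] := cone_point_coord 1 x; rewrite expr1n.
exact.
Qed.

End Link.

(** * Orbits and the period lattice *)

Section ConeOrbits.
Context {R : realType}.
Implicit Types (y : 'rV[R]_(1 + 5)) (x : 'rV[R]_5).

Lemma ang_coord y : [/\ ang y 0 0 = y 0 4 / 2 + y 0 5 / 3,
  ang y 0 1 = y 0 4 / 2 + y 0 5 / 3 + y 0 3 & ang y 0 2 = 2 / 3 * y 0 5].
Proof.
have E j : ang y 0 j = \sum_k y 0 k * ang_mx k j by rewrite mxE.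
by split; rewrite E sum6 !mxE /=; ring.
Qed.

Lemma amp_pos y : cone_X5 y -> forall j, 0 < amp y 0 j.
Proof.
move=> Cy; have [[r0 p0 q0 c0 s0] _ _ _] := domain_facts Cy => j.
by rewrite mxE; have [->|[->| ->]] := ord3P j; rewrite /= ?mulr_gt0.
Qed.

Lemma amp_inj y y' : cone_X5 y -> cone_X5 y' -> amp y = amp y' ->
  [/\ y 0 0 = y' 0 0, y 0 1 = y' 0 1 & y 0 2 = y' 0 2].
Proof.
move=> Cy Cy' E; have [[r0 p0 q0 c0 s0] tE Hq Hc] := domain_facts Cy.
have [[r0' p0' q0' c0' s0'] tE' Hq' Hc'] := domain_facts Cy'.
have rE : y 0 0 = y' 0 0.
  have := sum_sqnorm_cone_map Cy.
  under eq_bigr do rewrite sqnorm_polar E; under eq_bigr do rewrite -(sqnorm_polar _ (ang y')).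
  rewrite (sum_sqnorm_cone_map Cy') => /eqP.
  by rewrite eqrXn2 ?ltW// => /eqP.
have nr : y' 0 0 != 0 by rewrite gt_eqF.
have /rowP E' := E; move: (E' 0) (E' 2); rewrite !mxE /= rE => E0 E2.
have qE : sigma y = sigma y' by apply: (mulfI nr).
have tE1 : y 0 1 = y' 0 1.
  by move: Hq; rewrite qE Hq' tE tE' => ?; lra.
have pE : rho y = rho y' by rewrite /rho tE1.
have np : rho y' != 0 by rewrite gt_eqF.
have cE : cos_half y = cos_half y'.
  by apply: (mulfI np); apply: (mulfI nr); rewrite -{1}pE.
split=> //; move: Cy Cy' => /cone_X5E[_ _ /andP[h1 h2]] /cone_X5E[_ _ /andP[h1' h2']].
have : y 0 2 / 2 = y' 0 2 / 2.
  by apply: cos_inj => //; rewrite in_itv /=; apply/andP; split; lra.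
by move=> ?; lra.
Qed.

(** If the arguments at [y'] exceed those at [y] by [k] times the angles of the
    generator plus [2 pi (m0, m1, m2)], then [phi], [tau], [chi] change by
    [2 pi (m1 - m0)], [2 pi (2 m0 - m2)] and [3/2 pi (k + 2 m2)]. Conversely, the
    periods of [phi], [tau], [chi] act as the powers 0, 2 and 1 of the generator. *)
Lemma cone_map_orbit y y' : cone_X5 y -> cone_X5 y' ->
  (exists k, cone_map y' = iter k generator (cone_map y)) <->
  cone_lattice period_lattice (y' - y).
Proof.
move=> Cy Cy'; rewrite cone_latticeP.
have B k : (y' - y) 0 k = y' 0 k - y 0 k by rewrite !mxE.
rewrite !B; have [a0 a1 a2] := ang_coord y; have [b0 b1 b2] := ang_coord y'.
have gamma k : [/\ (ang y + generator_angle *+ k) 0 0 = ang y 0 0 + k%:R * (pi / 2),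
  (ang y + generator_angle *+ k) 0 1 = ang y 0 1 + k%:R * (pi / 2) &
  (ang y + generator_angle *+ k) 0 2 = ang y 0 2 + k%:R * pi].
  have D j : (ang y + generator_angle *+ k) 0 j = ang y 0 j + k%:R * generator_angle 0 j.
    by rewrite mxE mulmxnE mulr_natl.
  by rewrite !D !mxE.
split=> [[k]|[v0 v1 v2 [k [l [m [w3 w4 w5]]]]]].
  rewrite iter_generator_polar => /esym /(polar_inj (amp_pos Cy) (amp_pos Cy'))[E ang_eq].
  have [g0 g1 g2] := gamma k.
  have [r_eq t_eq h_eq] := amp_inj Cy Cy' E.
  have [m0 e0] := ang_eq 0; have [m1 e1] := ang_eq 1; have [m2 e2] := ang_eq 2.
  move: e0 e1 e2; rewrite g0 g1 g2 a0 a1 a2 b0 b1 b2 => e0 e1 e2.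
  rewrite r_eq t_eq h_eq !subrr; split=> //.
  exists (m1 - m0), (2 * m0 - m2), (k%:Z + 2 * m2).
  rewrite !(intrD, intrM, mulrNz) -!pmulrn.
  by split; lra.
(* The translation is the [k']-th power of the generator, [k'] the residue of [m + 2 l]. *)
have [q [k' mE]] : exists (q : int) (k' : nat), m + 2 * l = 4 * q + k'%:Z.
  exists ((m + 2 * l) %/ 4)%Z, `|((m + 2 * l) %% 4)%Z|%N.
  by rewrite gez0_abs ?modz_ge0// {1}(divz_eq (m + 2 * l) 4) mulrC.
exists k'; rewrite iter_generator_polar /cone_map.
have -> : amp y' = amp y.
  apply/rowP => j; rewrite !mxE /rho /sigma /cos_half /sin_half.
  have -> : y' 0 0 = y 0 0 by lra.
  have -> : y' 0 1 = y 0 1 by lra.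
  by have -> : y' 0 2 = y 0 2 by lra.
have mR : m%:~R = 4 * q%:~R + k'%:R - 2 * l%:~R :> R.
  have := congr1 (fun z : int => z%:~R : R) mE.
  by rewrite !(intrD, intrM) -!pmulrn => ?; lra.
have [g0 g1 g2] := gamma k'; apply/esym/polar_shift => j.
have [->|[->| ->]] := ord3P j.
- by exists q; rewrite g0 a0 b0; nra.
- by exists (q + k); rewrite g1 a1 b1 intrD; nra.
- by exists (2 * q - l); rewrite g2 a2 b2 !(intrD, intrM, mulrNz) -!pmulrn; nra.
Qed.

End ConeOrbits.

(** * The two isometries *)

Section LocalLifts.
Context {R : realType}.

Lemma jac_eq_on {n m : nat} (A : set 'rV[R]_n) (f g : 'rV[R]_n -> 'rV[R]_m) (x : 'rV[R]_n) :
  open A -> (forall z, A z -> f z = g z) -> A x -> differentiable f x -> jac f x = jac g x.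
Proof.
move=> oA fg Ax df; have dg := differentiable_eq_on oA fg Ax df.
apply/matrixP => i j; rewrite !jac_pd//; apply: (pd_eq_on _ oA) => // z Az.
by rewrite fg.
Qed.

(** One global lift serves as the local lift at every point; it is only compared
    with the map [f] on [A], where both have the same derivatives. *)
Lemma isometry_of_lift {n : nat} (A L : set 'rV[R]_n) (g : 'rV[R]_n -> 'M[R]_n)
    (M : set 'rV[R]_(3 + 3)) (f : 'rV[R]_n -> 'rV[R]_(3 + 3)) (lift : 'rV[R]_n -> M) :
  open A -> smooth_on A f -> (forall x, A x -> g x = jac f x *m (jac f x)^T) ->
  (forall x, A x -> set_val (lift x) = f x) ->
  (forall x x', A x -> A x' ->
     (exists k, f x' = iter k generator (f x)) <-> L (x' - x)) ->
  (forall x, A x -> regular (f x)) ->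
  (forall p : M, regular (set_val p) -> exists2 x, A x & f x = set_val p) ->
  (forall V (p : M), open V -> V (set_val p) ->
     exists2 q : M, V (set_val q) & regular (set_val q)) ->
  isometry_onto_dense_open A L g (fun x => orbit_proj (lift x)).
Proof.
move=> oA sf gE fE fL freg fsurj Mdense.
have [opn dns] : open [set orbit_proj (lift x) | x in A] /\ dense [set orbit_proj (lift x) | x in A].
  apply: regular_image => //.
    by move=> x Ax; rewrite fE//; exact: freg.
  move=> p /fsurj[x Ax xp]; exists x => //.
  by apply: val_inj; exact: etrans (fE x Ax) xp.
split=> //.
- move=> x Ax; exists A, lift; split=> //.
  + by apply: (smooth_eq oA _ sf) => z Az; rewrite /= fE.
  + move=> z Az; rewrite /pullback mulmx1 gE// -jacE.
    have E w : A w -> f w = (set_val \o lift) w by move=> Aw; rewrite /= fE.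
    by rewrite -(jac_eq_on oA E Az)//; exact: smooth_differentiable sf Az.
- by move=> x x' Ax Ax'; rewrite orbit_projP !fE//; exact: fL.
Qed.

End LocalLifts.

Section ConeIsometry.
Context {R : realType}.
Implicit Types (y : 'rV[R]_(1 + 5)) (x : 'rV[R]_5) (p q : 'rV[R]_(3 + 3)).

(** The moduli [A] determine [r^2 = |A|^2], [t = - 3/2 (A_0^2 + A_1^2) / r^2] and
    [theta = 2 acos (A_0 / sqrt (A_0^2 + A_1^2))], and the arguments determine
    [phi], [tau], [chi] linearly. *)
Lemma cone_map_surj p : regular p -> exists2 y, cone_X5 y & cone_map y = p.
Proof.
move=> rp; have [A [a [A0 ->]]] := polar_surj rp.
have [[a0 a1] a2] := (A0 0, A0 1, A0 2).
pose N := A 0 0 ^+ 2 + A 0 1 ^+ 2.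
have N0 : 0 < N by rewrite addr_gt0// exprn_gt0.
have r20 : 0 < N + A 0 2 ^+ 2 by rewrite addr_gt0// exprn_gt0.
pose r := Num.sqrt (N + A 0 2 ^+ 2).
have r0 : 0 < r by rewrite sqrtr_gt0.
have r2 : r ^+ 2 = N + A 0 2 ^+ 2 by rewrite sqr_sqrtr// ltW.
pose M := Num.sqrt N; have M0 : 0 < M by rewrite sqrtr_gt0.
have M2 : M ^+ 2 = N by rewrite sqr_sqrtr// ltW.
pose u := A 0 0 / M.
have u0 : 0 < u by rewrite divr_gt0.
have u1 : u < 1.
  rewrite ltr_pdivrMr// mul1r -(ltr_pXn2r (n := 2)) ?nnegrE ?ltW// M2 /N ltrDl.
  by rewrite exprn_gt0.
have u_itv : -1 <= u <= 1 by apply/andP; split; lra.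
pose w := N / r ^+ 2; pose t := - (3 / 2) * w.
pose y : 'rV[R]_(1 + 5) := cone_point r
  (\row_j [:: t; 2 * acos u; a 0 1 - a 0 0; 2 * a 0 0 - a 0 2; 3 / 2 * a 0 2]`_j).
have [y0 y1 [y2 y3 y4 y5]] : [/\ y 0 0 = r, y 0 1 = t & [/\ y 0 2 = 2 * acos u,
    y 0 3 = a 0 1 - a 0 0, y 0 4 = 2 * a 0 0 - a 0 2 & y 0 5 = 3 / 2 * a 0 2]].
  have := cone_point_coord r (\row_j [:: t; 2 * acos u; a 0 1 - a 0 0; 2 * a 0 0 - a 0 2;
     3 / 2 * a 0 2]`_j).
  by rewrite -/y => -[-> -> [-> -> -> ->]]; rewrite !mxE.
have w0 : 0 < w by rewrite divr_gt0// exprn_gt0.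
have w1 : w < 1.
  by rewrite ltr_pdivrMr ?exprn_gt0// mul1r r2 ltrDl exprn_gt0.
have nr : r != 0 by rewrite gt_eqF.
have nM : M != 0 by rewrite gt_eqF.
have acos_lt : acos u < pi / 2.
  have pi0 := pi_gt0 R; rewrite -ltr_cos ?in_itv /=; first by rewrite acosK ?in_itv// cos_pihalf.
    by rewrite acos_ge0 ?acos_lepi.
  by apply/andP; split; lra.
have Cy : cone_X5 y.
  apply/cone_X5E; rewrite y0 y1 y2 /t; split=> //; apply/andP; split.
  - by move: w1; clear; move: w => v; lra.
  - by move: w0; clear; move: w => v; lra.
  - by rewrite mulr_gt0// acos_gt0// u1 andbT; lra.
  - by move: acos_lt; clear; move: (acos u) => v; lra.
exists y => //; rewrite /cone_map.
have half : y 0 2 / 2 = acos u by rewrite y2 mulrC mulKf.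
have rhoE : rho y = M / r.
  have E : - (2 / 3) * y 0 1 = (M / r) ^+ 2 by rewrite y1 /t /w expr_div_n M2; field.
  by rewrite /rho E sqrtr_sqr ger0_norm// divr_ge0// ltW.
have sigmaE : sigma y = A 0 2 / r.
  have E : 1 + 2 / 3 * y 0 1 = (A 0 2 / r) ^+ 2.
    have nr2 : N + A 0 2 ^+ 2 != 0 by rewrite gt_eqF.
    by rewrite y1 /t /w expr_div_n r2; field.
  by rewrite /sigma E sqrtr_sqr ger0_norm// divr_ge0// ltW.
have cE : cos_half y = A 0 0 / M by rewrite /cos_half half acosK.
have sE : sin_half y = A 0 1 / M.
  rewrite /sin_half half sin_acos//.
  have E : 1 - u ^+ 2 = (A 0 1 / M) ^+ 2.
    have nN : N != 0 by rewrite gt_eqF.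
    by rewrite /u !expr_div_n M2; apply: (mulIf nN); rewrite mulrBl !divfK// mul1r /N addrC addKr.
  by rewrite E sqrtr_sqr ger0_norm// divr_ge0// ltW.
have -> : amp y = A.
  apply/rowP => j; rewrite mxE y0 rhoE sigmaE cE sE.
  by have [->|[->| ->]] := ord3P j => /=; field; rewrite ?nr ?nM.
congr polar; have [e0 e1 e2] := ang_coord y; move: e0 e1 e2; rewrite y3 y4 y5 => e0 e1 e2.
by apply/rowP => j; have [->|[->| ->]] := ord3P j; rewrite ?e0 ?e1 ?e2; field.
Qed.

Lemma cone_map_regular y : cone_X5 y -> regular (cone_map y).
Proof. by move=> Cy j; rewrite sqnorm_polar exprn_gt0// amp_pos. Qed.

Lemma cone_map_scale (r : R) x : cone_map (cone_point r x) = r *: link_map x.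
Proof.
have [c0 c1 [c2 c3 c4 c5]] := cone_point_coord r x.
have [d0 d1 [d2 d3 d4 d5]] := cone_point_coord 1 x.
rewrite /link_map /cone_map /polar.
have -> : ang (cone_point r x) = ang (cone_point 1 x).
  have [e0 e1 e2] := ang_coord (cone_point r x); have [f0 f1 f2] := ang_coord (cone_point 1 x).
  apply/rowP => j; have [->|[->| ->]] := ord3P j;
    by rewrite ?e0 ?e1 ?e2 ?f0 ?f1 ?f2 ?c3 ?c4 ?c5 ?d3 ?d4 ?d5.
have ampE y j : amp y 0 j =
    [:: y 0 0 * (rho y * cos_half y); y 0 0 * (rho y * sin_half y); y 0 0 * sigma y]`_j.
  by rewrite mxE.
have E j : amp (cone_point r x) 0 j = r * amp (cone_point 1 x) 0 j.
  rewrite !ampE /rho /sigma /cos_half /sin_half c0 c1 c2 d0 d1 d2.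
  by have [->|[->| ->]] := ord3P j; rewrite /= mul1r.
rewrite scale_row_mx; congr row_mx; apply/rowP => j;
  by rewrite [LHS]mxE [RHS]mxE [X in _ = r * X]mxE E mulrA.
Qed.

Lemma link_map_S5 x : X5_domain x -> S5 (link_map x).
Proof.
move=> Dx; apply/S5E; rewrite sum_sqnorm_cone_map; last exact: cone_X5_point ltr01 Dx.
by have [-> _ _] := cone_point_coord 1 x; rewrite expr1n.
Qed.

Definition cone_lift y : [set: 'rV[R]_(3 + 3)] := exist _ (cone_map y) (in_setT _).

Let pole : 'rV[R]_(3 + 3) := polar (delta_mx 0 0) 0.

Let pole_S5 : S5 pole.
Proof.
apply/S5E; under eq_bigr do rewrite sqnorm_polar !mxE /=.
by rewrite !big_ord_recl big_ord0 /= expr1n expr0n !addr0.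
Qed.

(** Outside the domain [link_map] need not lie on the sphere; there the value is
    an arbitrary point. *)
Definition link_lift x : @S5 R :=
  insubd (exist _ pole (mem_set pole_S5) : @S5 R) (link_map x).

Lemma link_liftE x : X5_domain x -> set_val (link_lift x) = link_map x.
Proof. by move=> Dx; apply: insubdK; apply: mem_set; exact: link_map_S5. Qed.

Lemma cone_isometry : isometry_onto_dense_open (cone_domain X5_domain)
  (cone_lattice period_lattice) (cone_metric X5_metric) (fun y => orbit_proj (cone_lift y)).
Proof.
apply: (isometry_of_lift open_cone_X5 cone_map_smooth) => //.
- by move=> y Cy; rewrite jac_gram.
- exact: cone_map_orbit.
- exact: cone_map_regular.
- by move=> p; exact: cone_map_surj.
- move=> V p oV Vp; have [q Vq rq] := regular_dense oV Vp.
  by exists (exist _ q (in_setT _)).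
Qed.

Lemma link_isometry : isometry_onto_dense_open X5_domain
  period_lattice X5_metric (fun x => orbit_proj (link_lift x)).
Proof.
have Cx x : X5_domain x -> cone_X5 (cone_point 1 x) by exact: cone_X5_point ltr01.
apply: (isometry_of_lift open_X5_domain link_map_smooth link_gram link_liftE).
- move=> x x' Dx Dx'; rewrite (cone_map_orbit (Cx x Dx) (Cx x' Dx')).
  rewrite cone_latticeP period_latticeP.
  have B k : (cone_point 1 x' - cone_point 1 x) 0 k = cone_point 1 x' 0 k - cone_point 1 x 0 k.
    by rewrite mxE [X in _ + X]mxE.
  have [c0 c1 [c2 c3 c4 c5]] := cone_point_coord 1 x.
  have [d0 d1 [d2 d3 d4 d5]] := cone_point_coord 1 x'.
  have B5 k : (x' - x) 0 k = x' 0 k - x 0 k by rewrite mxE [X in _ + X]mxE.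
  rewrite !B !B5 c0 c1 c2 c3 c4 c5 d0 d1 d2 d3 d4 d5 subrr.
  by split=> [[_]|[]].
- by move=> x Dx; apply: cone_map_regular; exact: Cx.
- move=> p rp; have [y Cy yp] := cone_map_surj rp.
  have y0 : y 0 0 = 1.
    have := sum_sqnorm_cone_map Cy; rewrite yp.
    have /S5E -> : S5 (set_val p) by apply: set_mem; exact: valP.
    move=> /esym/eqP; rewrite sqrf_eq1 => /orP[/eqP//|/eqP y0].
    by have [+ _] := Cy; rewrite y0 oppr_gt0 ltr10.
  exists (rsubmx y); first by case: Cy.
  rewrite /link_map -yp; congr cone_map; rewrite -[RHS]hsubmxK /cone_point; congr row_mx.
  apply/rowP => i; rewrite (ord1 i) !mxE mulr1n -[LHS]y0; congr (y _ _); exact: val_inj.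
- move=> V p oV Vp; have [|q [Vq rq Sq]] := sphere_regular_dense oV Vp.
    by apply: set_mem; exact: valP.
  by exists (exist _ q (mem_set Sq)).
Qed.

Lemma link_cone_compatible (r : R) x (p : @S5 R) (q : [set: 'rV[R]_(3 + 3)]) :
  X5_domain x -> orbit_proj (link_lift x) = orbit_proj p -> set_val q = r *: set_val p ->
  orbit_proj (cone_lift (cone_point r x)) = orbit_proj q.
Proof.
move=> Dx /orbit_projP[k pk] qp; apply/orbit_projP; exists k.
have coneE y : set_val (cone_lift y) = cone_map y by [].
rewrite qp pk link_liftE// coneE cone_map_scale.
by elim: k {pk} => [//|k IH]; rewrite !iterS -IH generator_scale.
Qed.

End ConeIsometry.

(** * The asymptotic cone *)

Section Asymptotics.
Context {R : realType}.
Implicit Types (x : 'rV[R]_5) (r : R).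

Lemma jac_s_of_radius r x :
  jac s_of_radius (cone_point r x) = block_mx (- (4 / 3) * r)%:M 0 0 1%:M.
Proof.
have dc (k : 'I_(1 + 5)) : differentiable (fun y : 'rV[R]_(1 + 5) => y 0 k) (cone_point r x).
  exact: differentiable_coord.
pose c : R := - (2 / 3).
have El y (j : 'I_1) : s_of_radius y 0 (lshift 5 j) = c * (y 0 0 * y 0 0).
  by rewrite /s_of_radius /cone_point row_mxEl mxE (ord1 j) mulr1n expr2.
have Er y (j : 'I_5) : s_of_radius y 0 (rshift 1 j) = y 0 (rshift 1 j).
  by rewrite /s_of_radius /cone_point row_mxEr mxE.
have dcst : differentiable (fun _ : 'rV[R]_(1 + 5) => c) (cone_point r x).
  exact: differentiable_cst.
have dq := differentiableM (dc 0) (dc 0).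
have dS : differentiable s_of_radius (cone_point r x).
  apply/differentiable_mxP => i k; rewrite (ord1 i); case: (split_ordP k) => j ->.
    under eq_fun do rewrite El; apply: differentiableM => //; exact: differentiable_cst.
  by under eq_fun do rewrite Er; exact: dc.
have l0 : lshift 5 (0 : 'I_1) = 0 :> 'I_(1 + 5) by apply: val_inj.
have [y0 _ _] := cone_point_coord r x.
apply/matrixP => i k; rewrite jac_pd//; case: (split_ordP k) => j ->.
  under eq_fun do rewrite El; rewrite (pdM _ dcst dq) pd_cst.
  rewrite (pdM _ (dc 0) (dc 0)) pd_coord y0 mul0r add0r -l0 (ord1 j).
  case: (split_ordP i) => a ->.
    rewrite block_mxEul mxE (ord1 a) !eqxx mulr1n /c /=.
    by field.
  by rewrite block_mxEdl mxE eq_rlshift mul0r mulr0 addr0 mulr0.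
under eq_fun do rewrite Er; rewrite pd_coord.
case: (split_ordP i) => a ->.
  by rewrite block_mxEur mxE eq_lrshift.
by rewrite block_mxEdr mxE eq_rshift.
Qed.

Lemma g_metricE (y : 'rV[R]_(1 + 5)) i j : let s := y 0 0 in let t := y 0 1 in
  let d (k : 'I_(1 + 5)) (i : 'I_(1 + 5)) : R := (i == k)%:R in
  let eta i := d 4 i + (1 - cos (y 0 2)) * d 3 i in
  g_metric y i j =
  1 / 4 * s * t * (d 2 i * d 2 j + sin (y 0 2) ^+ 2 * (d 3 i * d 3 j))
  + (t - s) / (4 * Q s) * (d 0 i * d 0 j)
  + 3 * (s - t) / (4 * t * (2 * t + 3)) * (d 1 i * d 1 j)
  + Q s / (t - s) *
    (((t / 3 + 1) * d 5 i - t / 2 * eta i) * ((t / 3 + 1) * d 5 j - t / 2 * eta j))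
  + t * (2 * t + 3) / (3 * (s - t)) *
    (((s / 3 + 1) * d 5 i - s / 2 * eta i) * ((s / 3 + 1) * d 5 j - s / 2 * eta j)).
Proof.
rewrite /= /g_metric; repeat (rewrite mxE || rewrite big_ord1).
by [].
Qed.

(** The Jacobian of [s = - 2/3 R^2] is diagonal, with [ds = - 4/3 R dR] and the
    other coordinates unchanged. *)
Lemma pullback_s_of_radius r x : let h := pullback s_of_radius g_metric (cone_point r x) in
  let g := g_metric (cone_point (- (2 / 3) * r ^+ 2) x) in
  [/\ h 0 0 = 16 / 9 * r ^+ 2 * g 0 0,
      forall j : 'I_5, h 0 (rshift 1 j) = - (4 / 3) * r * g 0 (rshift 1 j) /\
                       h (rshift 1 j) 0 = - (4 / 3) * r * g (rshift 1 j) 0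
    & forall i j : 'I_5, h (rshift 1 i) (rshift 1 j) = g (rshift 1 i) (rshift 1 j)].
Proof.
have sE : s_of_radius (cone_point r x) = cone_point (- (2 / 3) * r ^+ 2) x.
  have [y0 _ _] := cone_point_coord r x.
  by rewrite /s_of_radius y0 row_mxKr.
move=> h g; have l0 : lshift 5 (0 : 'I_1) = 0 :> 'I_(1 + 5) by apply: val_inj.
have hE : h = block_mx (- (4 / 3) * r)%:M 0 0 1%:M *m g *m
              (block_mx (- (4 / 3) * r)%:M 0 0 1%:M)^T.
  by rewrite /h /pullback -jacE jac_s_of_radius sE.
rewrite hE {hE h}; clearbody g; rewrite -[g]submxK tr_block_mx !trmx0 !tr_scalar_mx.
rewrite !mulmx_block !mul0mx !mulmx0 !mul1mx !mulmx1 !addr0 !add0r -l0.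
split=> [|j|i j].
- by rewrite !block_mxEul mul_scalar_mx mul_mx_scalar !mxE; field.
- by rewrite !block_mxEur !block_mxEdl mul_scalar_mx mul_mx_scalar !mxE.
- by rewrite !block_mxEdr.
Qed.

Lemma cvg_inv_sqr : r ^- 2 @[r --> +oo] --> (0 : R).
Proof.
apply/cvgrPdist_lt => e e0; near=> r.
have r1 : 1 < r by near: r; exact: nbhs_pinfty_gt.
have r0 : 0 < r by rewrite (lt_trans _ r1).
have re : e^-1 < r by near: r; apply: nbhs_pinfty_gt; exact: num_real.
rewrite sub0r normrN ger0_norm ?invr_ge0 ?exprn_ge0 ?ltW//.
rewrite invf_plt ?posrE ?exprn_gt0//; apply: lt_trans re _.
by rewrite expr2 ltr_pMr.
Unshelve. all: by end_near. Qed.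

(** In the variable [v = r^-2] the coefficients are rational functions that are
    regular at [v = 0]. *)
Lemma cvg_rational_coeffs (t : R) : let v r : R := r ^- 2 in
  [/\ (t * v r + 2 / 3) @[r --> +oo] --> (2 / 3 : R),
      (8 / 27 - 2 / 3 * v r - 27 / 2 * (v r * (v r * v r))) @[r --> +oo] --> (8 / 27 : R)
    & forall a b : R, ((- (2 / 9) + v r) * a + b / 3) @[r --> +oo] --> (- (2 / 9) * a + b / 3 : R)].
Proof.
move=> v; have hv : v r @[r --> +oo] --> (0 : R) by exact: cvg_inv_sqr.
have cc (c : R) : (fun _ : R => c) r @[r --> (+oo : set_system R)] --> c by exact: cvg_cst.
split.
- have H : (t * v r + 2 / 3) @[r --> +oo] --> (t * 0 + 2 / 3 : R).
    exact: (cvgD (cvgM (cc t) hv) (cc (2 / 3))).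
  by move: H; rewrite mulr0 add0r.
- have H : (8 / 27 - 2 / 3 * v r - 27 / 2 * (v r * (v r * v r))) @[r --> +oo]
      --> (8 / 27 - 2 / 3 * 0 - 27 / 2 * (0 * (0 * 0)) : R).
    exact: (cvgB (cvgB (cc (8 / 27)) (cvgM (cc (2 / 3)) hv))
                 (cvgM (cc (27 / 2)) (cvgM hv (cvgM hv hv)))).
  by move: H; rewrite !mulr0 !subr0.
- move=> a b; have H : ((- (2 / 9) + v r) * a + b / 3) @[r --> +oo] --> ((- (2 / 9) + 0) * a + b / 3 : R).
    exact: (cvgD (cvgM (cvgD (cc (- (2 / 9))) hv) (cc a)) (cc (b / 3))).
  by move: H; rewrite addr0.
Qed.

Lemma Q_neg_sqr (t r : R) : r != 0 -> let s := - (2 / 3) * r ^+ 2 in let v := r ^- 2 in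
  [/\ Q s = r ^+ 4 * (8 / 27 - 2 / 3 * v - 27 / 2 * (v * (v * v))),
      t - s = r ^+ 2 * (t * v + 2 / 3)
    & s / 3 + 1 = r ^+ 2 * (- (2 / 9) + v)].
Proof. by move=> r0 s v; rewrite /Q /s /v; split; field; rewrite ?r0 ?oppr_eq0 ?pnatr_eq0. Qed.

(** Divided by [r^2], each coefficient of [g] is a rational function of [v = r^-2],
    and its value at [v = 0] is the coefficient of the cone. The form [ds]
    occurs in [g] only as [ds^2], so that there are no cross terms with [dR]. *)
Theorem cone_asymptotics x : X5_domain x ->
  let h r := pullback s_of_radius g_metric (cone_point r x) in
  [/\ h r 0 0 @[r --> +oo] --> (1 : R),
      forall j : 'I_5, forall r : R, h r 0 (rshift 1 j) = 0 /\ h r (rshift 1 j) 0 = 0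
    & forall i j : 'I_5,
        r ^- 2 * h r (rshift 1 i) (rshift 1 j) @[r --> +oo] --> X5_metric x i j].
Proof.
move=> [/andP[t1 t2] _] h; set t := x 0 0 in t1 t2 *.
have [den num vec] := cvg_rational_coeffs t.
have cc (c : R) : (fun _ : R => c) r @[r --> (+oo : set_system R)] --> c by exact: cvg_cst.
have nt0 : t != 0 by rewrite lt_eqF.
have nt3 : 2 * t + 3 != 0 by rewrite gt_eqF//; lra.
have n23 : 2 / 3 != 0 :> R by rewrite gt_eqF.
have n827 : 8 / 27 != 0 :> R by rewrite gt_eqF.
pose D r : R := t * r ^- 2 + 2 / 3.
pose N r : R := 8 / 27 - 2 / 3 * r ^- 2 - 27 / 2 * (r ^- 2 * (r ^- 2 * r ^- 2)).
have cD : D r @[r --> +oo] --> (2 / 3 : R) by [].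
have cN : N r @[r --> +oo] --> (8 / 27 : R) by [].
have r_neq0 : \forall r \near +oo, r != 0 :> R.
  by near=> r; rewrite gt_eqF//; near: r; exact: nbhs_pinfty_gt.
have D_neq0 : \forall r \near +oo, D r != 0 by exact: cvgr_neq0 cD n23.
have N_neq0 : \forall r \near +oo, N r != 0 by exact: cvgr_neq0 cN n827.
have gE r i j : r != 0 -> D r != 0 -> N r != 0 ->
  let d (k : 'I_(1 + 5)) (i : 'I_(1 + 5)) : R := (i == k)%:R in
  let eta i := d 4 i + (1 - cos (x 0 1)) * d 3 i in
  let W i := (- (2 / 9) + r ^- 2) * d 5 i + eta i / 3 in
  r ^- 2 * g_metric (cone_point (- (2 / 3) * r ^+ 2) x) i j =
  - (t / 6) * (d 2 i * d 2 j + sin (x 0 1) ^+ 2 * (d 3 i * d 3 j))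
  + D r / (4 * r ^+ 4 * N r) * (d 0 i * d 0 j)
  + - (3 / (4 * t * (2 * t + 3))) * (d 1 i * d 1 j) * D r
  + N r / D r *
    (((t / 3 + 1) * d 5 i - t / 2 * eta i) * ((t / 3 + 1) * d 5 j - t / 2 * eta j))
  + - (t * (2 * t + 3) / 3) * (W i * W j / D r).
  move=> r0 D0 N0 d eta W; have [E1 E2 E3] := Q_neg_sqr t r0.
  have [c0 c1 [c2 _ _ _]] := cone_point_coord (- (2 / 3) * r ^+ 2) x.
  rewrite g_metricE c0 c1 c2 -/t.
  have -> : - (2 / 3) * r ^+ 2 - t = - (r ^+ 2 * D r) by rewrite -E2 opprB.
  rewrite E1 E2 E3 -/(D r) -/(N r) /W /eta /d.
  move: (D r) (N r) D0 N0 => D' N' D0 N0.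
  by field; rewrite r0 D0 N0 nt0 nt3.
have hE r := pullback_s_of_radius r x; split=> [|j r|i j].
- have H : 16 / 9 * (D r / (4 * N r)) @[r --> +oo] --> (16 / 9 * ((2 / 3) / (4 * (8 / 27))) : R).
    apply: (cvgM (cc _) (cvgM cD (cvgV _ (cvgM (cc 4) cN)))).
    by rewrite mulf_neq0.
  have -> : (1 : R) = 16 / 9 * ((2 / 3) * (4 * (8 / 27))^-1) by field.
  apply: cvg_trans H; apply: near_eq_cvg; near=> r.
  have r0 : r != 0 by near: r.
  have D0 : D r != 0 by near: r.
  have N0 : N r != 0 by near: r.
  have [-> _ _] := hE r; have nr2 : r ^- 2 != 0 by rewrite invr_eq0 expf_neq0.
  apply: (mulfI nr2); rewrite [in RHS]mulrCA gE//= !(mulr0, addr0, add0r, mul0r, mulr1, subr0).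
  by field; rewrite r0 N0 D0.
- have [_ /(_ j)[-> ->] _] := hE r.
  have [v0 v1 v2 v3 [v4 v5]] := rshift1_eq j.
  by rewrite !g_metricE v0 /=; split; ring.
- have [v0 v1 v2 v3 [v4 v5]] := rshift1_eq i.
  have [u0 u1 u2 u3 [u4 u5]] := rshift1_eq j.
  pose eta (k : 'I_5) : R := (k == 3)%:R + (1 - cos (x 0 1)) * (k == 2)%:R.
  pose d (l k : 'I_5) : R := (k == l)%:R.
  pose W r k := (- (2 / 9) + r ^- 2) * d 4 k + eta k / 3.
  pose W0 k := - (2 / 9) * d 4 k + eta k / 3.
  pose a := - (t / 6) * (d 1 i * d 1 j + sin (x 0 1) ^+ 2 * (d 2 i * d 2 j)).
  pose b := - (3 / (4 * t * (2 * t + 3))) * (d 0 i * d 0 j).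
  pose c := ((t / 3 + 1) * d 4 i - t / 2 * eta i) * ((t / 3 + 1) * d 4 j - t / 2 * eta j).
  pose e := - (t * (2 * t + 3) / 3).
  have cV : (D r)^-1 @[r --> +oo] --> ((2 / 3)^-1 : R) by exact: cvgV n23 cD.
  have cW k : W r k @[r --> +oo] --> W0 k by exact: (vec (d 4 k) (eta k)).
  have H : a + b * D r + N r / D r * c + e * (W r i * W r j / D r) @[r --> +oo] -->
    a + b * (2 / 3) + (8 / 27) / (2 / 3) * c + e * (W0 i * W0 j / (2 / 3)).
    apply: cvgD; last exact: (cvgM (cc e) (cvgM (cvgM (cW i) (cW j)) cV)).
    apply: cvgD; last exact: (cvgM (cvgM cN cV) (cc c)).
    exact: (cvgD (cc a) (cvgM (cc b) cD)).
  have lim_eq : a + b * (2 / 3) + (8 / 27) / (2 / 3) * c + e * (W0 i * W0 j / (2 / 3)) =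
     X5_metric x i j.
    by rewrite X5_metricE /a /b /c /e /W0 /eta /d -/t; field; rewrite nt0 nt3.
  rewrite -lim_eq.
  apply: cvg_trans H; apply: near_eq_cvg; near=> r.
  have r0 : r != 0 by near: r.
  have D0 : D r != 0 by near: r.
  have N0 : N r != 0 by near: r.
  have [_ _ ->] := hE r; rewrite gE//= v1 v2 v3 v4 v5 u1 u2 u3 u4 u5.
  by rewrite /a /b /c /e /W /eta /d mul0r mulr0 addr0.
Unshelve. all: by end_near.
Qed.

End Asymptotics.

(** * The theorem *)

Theorem mainTheorem3 (R : realType) :
  (* [h r] is the metric [g] at [(r, x)], in the coordinates
     [(R, t, theta, phi, tau, chi)] *)
  (forall x : 'rV[R]_5, X5_domain x ->
     let h (r : R) := pullback s_of_radius g_metric (cone_point r x) in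
     [/\ h r 0 0 @[r --> +oo] --> (1 : R),
         forall r : R, 0 < r -> g_domain (s_of_radius (cone_point r x)) ->
           forall j : 'I_5, h r 0 (rshift 1 j) = 0 /\ h r (rshift 1 j) 0 = 0
       & forall i j : 'I_5,
           r ^- 2 * h r (rshift 1 i) (rshift 1 j) @[r --> +oo]
             --> X5_metric x i j])
  /\ einstein (@X5_domain R) X5_metric 4
  /\ sasakian (@X5_domain R) period_lattice X5_metric
  /\ (exists (F : 'rV[R]_5 -> orbit_space S5)
             (G : 'rV[R]_(1 + 5) -> orbit_space [set: 'rV[R]_(3 + 3)]),
        [/\ isometry_onto_dense_open X5_domain period_lattice X5_metric F,
            isometry_onto_dense_open (cone_domain X5_domain)
              (cone_lattice period_lattice) (cone_metric X5_metric) G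
          & forall (r : R) (x : 'rV[R]_5), 0 < r -> X5_domain x ->
            forall (p : @S5 R) (q : [set: 'rV[R]_(3 + 3)]),
              F x = orbit_proj p -> set_val q = r *: set_val p ->
              G (cone_point r x) = orbit_proj q]).
Proof.
split=> [x Dx h|].
  have [h00 h0j hij] := cone_asymptotics Dx.
  by split=> // r _ _ j; exact: h0j.
split; first exact: X5_einstein.
split; first exact: X5_sasakian.
exists (fun x => orbit_proj (link_lift x)), (fun y => orbit_proj (cone_lift y)).
split; [exact: link_isometry|exact: cone_isometry|].
by move=> r x _ Dx p q; exact: link_cone_compatible.
Qed.
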